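(* Let $\Omega,\Omega_1,\Omega_2,\ldots$ be bounded open subsets of $\mathbb{R}^d$. Suppose that the $d$-dimensional Hausdorff measure of $\partial\Omega$ and of $\partial\Omega_n$, for all $n\in\mathbb{N}$, is zero, and that $\Omega_n\downarrow\Omega$ as $n\to\infty$. Write $\mathscr{E}=\mathscr{E}(\Omega)$, $\mathcal{A}=\mathcal{A}(\Omega)$ (the pseudo-Dirichlet Stokes operator in $\mathscr{E}$) and $\mathcal{I}$ for the identity operator on $\mathscr{E}$. For each $n\in\mathbb{N}$ write $\mathscr{E}_n=\mathscr{E}(\Omega_n)$, let $\mathcal{I}_n$ be the identity operator on $\mathscr{E}_n$ and let $\mathcal{A}_n=\mathcal{A}(\Omega_n)$ be the pseudo-Dirichlet Stokes operator in $\mathscr{E}_n$. For $f\in\mathscr{E}$ let $\tilde f\in L^2(\mathbb{R}^d,\mathbb{R}^d)$ be the extension of $f$ by $0$ to $\mathbb{R}^d$; then $\tilde f|_{\Omega_n}\in\mathscr{E}_n$ for all $n$. For every $f\in\mathscr{E}$, $$\lim_{n\to\infty}\Bigl(\bigl(\mathcal{I}_n+\mathcal{A}_n\bigr)^{-1}\bigl(\tilde f|_{\Omega_n}\bigr)\Bigr)\Big|_{\Omega}=(\mathcal{I}+\mathcal{A})^{-1}f\qquad\text{in } L^2(\Omega,\mathbb{R}^d).$$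
   Context: All function spaces are real. For an open set $\Omega\subset\mathbb{R}^d$, the space $L^2(\Omega,\mathbb{R}^d)$ carries the scalar product $\langle u,v\rangle=\int_\Omega u\cdot v$. Let $\Omega\subset\mathbb{R}^d$ be open with $\partial\Omega$ of zero $d$-dimensional Hausdorff measure. Define $$\mathscr{W}(\Omega)=\bigl\{U|_\Omega:\ U\in H^1(\mathbb{R}^d,\mathbb{R}^d),\ U=0 \text{ a.e. in }\mathbb{R}^d\setminus\overline{\Omega},\ \operatorname{div}U=0\text{ in }\mathbb{R}^d\bigr\},$$ equipped with the $H^1(\Omega,\mathbb{R}^d)$-norm, and let $\mathscr{E}(\Omega)$ be the closure of $\mathscr{W}(\Omega)$ in $L^2(\Omega,\mathbb{R}^d)$, which is a Hilbert space with the $L^2$ scalar product. Pseudo-Dirichlet Stokes operator: $\mathcal{A}(\Omega)$ is the self-adjoint operator in $\mathscr{E}(\Omega)$ associated with the closed symmetric positive densely defined form $\mathfrak{a}(u,v)=\sum_{j=1}^d\int_\Omega\partial_j u\cdot\partial_j v$, $u,v\in\mathscr{W}(\Omega)$. That is, $u\in D(\mathcal{A}(\Omega))$ and $\mathcal{A}(\Omega)u=w$ if and only if $u\in\mathscr{W}(\Omega)$, $w\in\mathscr{E}(\Omega)$ and $\mathfrak{a}(u,v)=\langle w,v\rangle$ for all $v\in\mathscr{W}(\Omega)$. Convergence of domains: $\Omega_n\downarrow\Omega$ as $n\to\infty$ means that $\Omega_n\supset\Omega_{n+1}\supset\overline{\Omega}$ for all $n\in\mathbb{N}$ and $\lim_{n\to\infty}|(\Omega_n\cap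 B)\setminus\overline{\Omega}|=0$ for every ball $B\subset\mathbb{R}^d$, where $|\cdot|$ denotes Lebesgue measure on $\mathbb{R}^d$. *)

(* Defs.v *)
From HB Require Import structures.
From mathcomp Require Import all_boot all_order all_algebra.
From mathcomp Require Import all_classical all_reals all_analysis.

Set Implicit Arguments.
Unset Strict Implicit.
Unset Printing Implicit Defensive.
Import Order.TTheory GRing.Theory Num.Theory.
Import numFieldNormedType.Exports.

Local Open Scope classical_set_scope.
Local Open Scope ring_scope.

(* The infimum of the total cost c of the countable (finite or infinite, P
   selects the indices in use) families of sets S i, i in D, that cover A. *)
Section covering_outer_measure.
Local Open Scope ereal_scope.
Context {R : realType} {T : Type} {I : pointedType}.
Variables (D : set I) (S : I -> set T) (c : I -> \bar R).

Definition covering_outer (A : set T) : \bar R :=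
  ereal_inf [set s | exists (P : pred nat) (F : nat -> I),
    [/\ forall k, P k -> D (F k),
        A `<=` \bigcup_(k in [set k | P k]) S (F k) &
        s = \sum_(k <oo | P k) c (F k)]].

Hypothesis c_ge0 : forall i, 0 <= c i.

Lemma covering_outer_ge0 A : 0 <= covering_outer A.
Proof.
by apply: le_ereal_inf_tmp => x [P [F [_ _ ->]]]; exact: nneseries_ge0.
Qed.

Lemma covering_outer0 : covering_outer set0 = 0.
Proof.
apply/eqP; rewrite eq_le covering_outer_ge0 andbT.
apply: ereal_inf_lbound; exists pred0, (fun=> point); split => //.
by rewrite eseries_pred0.
Qed.

Lemma le_covering_outer : {homo covering_outer : A B / A `<=` B >-> A <= B}.
Proof.
move=> A B AB; apply/ereal_inf_le_tmp => x [P [F [DF BF ->]]].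
by exists P, F; split => //; exact: subset_trans BF.
Qed.

Lemma covering_outer_sigma_subadditive : sigma_subadditive covering_outer.
Proof.
move=> A; have [[i ioo]|] := pselect (exists i, covering_outer (A i) = +oo).
  rewrite (eseries_pinfty _ _ ioo) ?leey// => n _.
  by rewrite -ltNye (lt_le_trans _ (covering_outer_ge0 _)).
rewrite -forallNE => Aoo.
suff add2e (e : {posnum R}) : covering_outer (\bigcup_n A n) <=
    \sum_(i <oo) covering_outer (A i) + e%:num%:E.
  by apply/lee_addgt0Pr => _/posnumP[].
rewrite (le_trans _ (epsilon_trick _ _ _))//; last first.
  by move=> n; exact: covering_outer_ge0.
pose cost (PF : pred nat * (nat -> I)) k := if PF.1 k then c (PF.2 k) else 0.
pose Q n (PF : pred nat * (nat -> I)) :=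
  [/\ forall k, PF.1 k -> D (PF.2 k),
      A n `<=` \bigcup_(k in [set k | PF.1 k]) S (PF.2 k) &
      \sum_(k <oo) cost PF k <=
        covering_outer (A n) + (e%:num / (2 ^ n.+1)%:R)%:E].
have [G QG] : {G : nat -> pred nat * (nat -> I) & forall n, Q n (G n)}.
  apply: (@choice _ _ Q) => n.
  have en1 : (0 < e%:num / (2 ^ n.+1)%:R :> R)%R by [].
  have fin : covering_outer (A n) \is a fin_num.
    rewrite ge0_fin_numE ?covering_outer_ge0// ltey.
    by apply/eqP; exact: Aoo.
  have [x [P [F [DF AF ->]]] /ltW xS] := lb_ereal_inf_adherent en1 fin.
  by exists (P, F); split => //=; rewrite /cost/= -eseries_mkcond.
have cost_ge0 n k : 0 <= cost (G n) k by rewrite /cost; case: ifP.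
have gcost_ge0 x : 0 <= uncurry (fun n => cost (G n)) x.
  by case: x => n k; exact: cost_ge0.
apply: (@le_trans _ _
    (\esum_(i in setT) (uncurry (fun n => cost (G n))) i)).
  apply: ereal_inf_lbound => /=.
  have /card_esym/ppcard_eqP[f] := card_nat2.
  exists (fun i => (G (f i).1).1 (f i).2), (fun i => (G (f i).1).2 (f i).2).
  split => [i|t [n _ Ant]|].
  - by have [+ _ _] := QG (f i).1; exact.
  - have [_ /(_ _ Ant)[k /= Pk Skt] _] := QG n.
    by exists (f^-1%FUN (n, k)) => /=; rewrite invK ?inE.
  - rewrite eseries_mkcond nneseries_esumT; last first.
      by move=> i; exact: cost_ge0 (f i).1 (f i).2.
    rewrite (reindex_esum setT setT f)//=.
    by apply: eq_esum => i _; case: (f i).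
rewrite (_ : esum _ _ = \sum_(i <oo) \sum_(j <oo) cost (G i) j); last first.
  rewrite nneseries_esumT; last by move=> i; exact: nneseries_ge0.
  under [RHS]eq_esum do rewrite nneseries_esumT//.
  rewrite esum_esum//; congr esum.
    by apply/seteqP; split => -[].
  by apply/funext => -[].
apply: lee_nneseries => n *; first exact: nneseries_ge0.
by have [] := QG n.
Qed.

End covering_outer_measure.

(* d-dimensional Lebesgue measure, obtained by Caratheodory's construction from
   the outer measure given by coverings with half-open boxes. The measurable
   sets of 'rV[R]_d are all the Lebesgue-measurable ones, so that the measure
   is complete. *)
Section lebesgue_measure_rV.
Context {R : realType} {d : nat}.

Definition box (ab : 'rV[R]_d * 'rV[R]_d) : set 'rV[R]_d :=
  [set x | forall i, ab.1 0 i < x 0 i <= ab.2 0 i].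

Definition box_volume (ab : 'rV[R]_d * 'rV[R]_d) : \bar R :=
  (\prod_i Num.max 0 (ab.2 0 i - ab.1 0 i))%:E.

Lemma box_volume_ge0 ab : (0 <= box_volume ab)%E.
Proof. by rewrite lee_fin prodr_ge0// => i _; rewrite le_max lexx. Qed.

Definition lebesgue_outer : set 'rV[R]_d -> \bar R :=
  covering_outer setT box box_volume.

HB.instance Definition _ := isOuterMeasure.Build R 'rV[R]_d lebesgue_outer
  (covering_outer0 setT box box_volume_ge0)
  (covering_outer_ge0 setT box box_volume_ge0)
  (@le_covering_outer _ _ _ setT box box_volume)
  (covering_outer_sigma_subadditive setT box box_volume_ge0).

HB.instance Definition _ := Measurable.copy 'rV[R]_d
  (caratheodory_type lebesgue_outer).

Definition lebesgue : set 'rV[R]_d -> \bar R := lebesgue_outer.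

Let lebesgue0 : lebesgue set0 = 0%E.
Proof. exact: (outer_measure0 lebesgue_outer). Qed.

Let lebesgue_ge0 A : (0 <= lebesgue A)%E.
Proof. exact: (outer_measure_ge0 lebesgue_outer). Qed.

Let lebesgue_semi_sigma_additive : semi_sigma_additive lebesgue.
Proof. exact: (@caratheodory_measure_sigma_additive _ _ lebesgue_outer). Qed.

HB.instance Definition _ := isMeasure.Build _ _ _ lebesgue
  lebesgue0 lebesgue_ge0 lebesgue_semi_sigma_additive.

End lebesgue_measure_rV.

Section euclidean.
Context {R : realType} {d : nat}.
Implicit Types (x y : 'rV[R]_d) (A : set 'rV[R]_d).

Definition dotr x y : R := \sum_i x 0 i * y 0 i.

(* The norm `|x| of the library is the maximum norm. *)
Definition enorm x : R := Num.sqrt (dotr x x).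

Definition eball x (r : R) : set 'rV[R]_d := [set y | enorm (y - x) < r].

Definition boundary A : set 'rV[R]_d := closure A `\` interior A.

Definition ediam A : \bar R :=
  ereal_sup [set (enorm (p.1 - p.2))%:E | p in A `*` A].

(* d-dimensional Hausdorff measure, without the normalizing constant, which is
   irrelevant to its null sets. *)
Definition hausdorff_pre (delta : R) : set 'rV[R]_d -> \bar R :=
  covering_outer [set E : set 'rV[R]_d | E !=set0 /\ (ediam E <= delta%:E)%E]
    id (fun E => ediam E ^+ d)%E.

Definition hausdorff A : \bar R :=
  ereal_sup [set hausdorff_pre delta A | delta in [set delta | 0 < delta]].

End euclidean.

(* Elements of L^2(Omega, R^d) and of its subspaces are represented by functions
   on the whole of R^d, of which only the values on Omega matter, and these only
   up to a Lebesgue-null set. *)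
Section sobolev.
Context {R : realType} {d : nat}.
Local Notation Rd := 'rV[R]_d.
Implicit Types (Omega : set Rd) (f g phi : Rd -> R) (u v w : Rd -> Rd).

Definition component u (i : 'I_d) : Rd -> R := fun x => u x 0 i.

Definition L2 Omega f : Prop := f \_ Omega \in Lfun lebesgue 2%:E.

Definition L2vec Omega u : Prop := forall i, L2 Omega (component u i).

Definition inner Omega u v : R :=
  \int[lebesgue]_(x in Omega) dotr (u x) (v x).

Definition L2norm Omega u : \bar R :=
  ('N[lebesgue]_2%:E [EFin \o ((enorm \o u) \_ Omega)])%E.

Definition partial (j : 'I_d) phi : Rd -> R := fun x => 'D_(delta_mx 0 j) phi x.

Definition smooth phi : Prop := forall s : seq 'I_d,
  let psi := foldr partial phi s in
  continuous psi /\ forall j x, derivable psi x (delta_mx 0 j).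

Definition test_function Omega phi : Prop :=
  [/\ smooth phi, compact (closure [set x | phi x != 0]) &
      closure [set x | phi x != 0] `<=` Omega].

Definition is_weak_partial Omega (j : 'I_d) f g : Prop :=
  [/\ L2 Omega f, L2 Omega g & forall phi, test_function Omega phi ->
    \int[lebesgue]_(x in Omega) (f x * partial j phi x) =
    - \int[lebesgue]_(x in Omega) (g x * phi x)].

(* Meaningful when f has a weak partial derivative in L^2(Omega), which is then
   unique up to a null set. *)
Definition weak_partial Omega (j : 'I_d) f : Rd -> R :=
  get [set g | is_weak_partial Omega j f g].

Definition weak_partial_vec Omega (j : 'I_d) u : Rd -> Rd :=
  fun x => \row_i weak_partial Omega j (component u i) x.

Definition H1 Omega u : Prop := L2vec Omega u /\
  forall i j, exists g, is_weak_partial Omega j (component u i) g.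

Definition div Omega u : Rd -> R :=
  fun x => \sum_i weak_partial Omega i (component u i) x.

End sobolev.

Section stokes.
Context {R : realType} {d : nat}.
Local Notation Rd := 'rV[R]_d.
Implicit Types (Omega : set Rd) (f u v w : Rd -> Rd).

Definition Wspace Omega u : Prop := exists U : Rd -> Rd,
  [/\ H1 setT U, ae_eq lebesgue (~` closure Omega) U (cst 0),
      ae_eq lebesgue setT (div setT U) (cst 0) & ae_eq lebesgue Omega u U].

Definition Espace Omega f : Prop := L2vec Omega f /\
  forall eps : R, 0 < eps -> exists2 w, Wspace Omega w &
    (L2norm Omega (f \- w)%R < eps%:E)%E.

Definition form_a Omega u v : R :=
  \sum_j inner Omega (weak_partial_vec Omega j u) (weak_partial_vec Omega j v).

(* u is in the domain of the pseudo-Dirichlet Stokes operator A(Omega), and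
   A(Omega) u = w. *)
Definition stokes Omega u w : Prop :=
  [/\ Wspace Omega u, Espace Omega w &
      forall v, Wspace Omega v -> form_a Omega u v = inner Omega w v].

Definition id_plus_stokes Omega u f : Prop :=
  exists2 w, stokes Omega u w & ae_eq lebesgue Omega (u \+ w) f.

(* (I + A(Omega))^-1 f *)
Definition resolvent Omega f : Rd -> Rd :=
  get [set u | id_plus_stokes Omega u f].

(* u is the one and only preimage of f under I + A(Omega). *)
Definition is_resolvent Omega f u : Prop := id_plus_stokes Omega u f /\
  forall v, id_plus_stokes Omega v f -> ae_eq lebesgue Omega v u.

Definition extend0 Omega f : Rd -> Rd := patch (cst 0) Omega f.

Definition decreases_to (Omega_ : nat -> set Rd) Omega : Prop :=
  (forall n, Omega_ n.+1 `<=` Omega_ n /\ closure Omega `<=` Omega_ n.+1) /\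
  forall x r, lebesgue ((Omega_ n `&` eball x r) `\` closure Omega)
    @[n --> \oo] --> 0%E.

End stokes.

(* Main.v *)
Require Import Defs.
From mathcomp Require Import all_boot all_order all_algebra.
From mathcomp Require Import all_classical all_reals all_analysis.
From mathcomp Require Import measurable_realfun ring lra.

(* Extending the elements of W(Omega) by zero identifies it, together with the
   weak gradients, with a closed subspace V(Omega) of a finite power of
   L^2(R^d), and the scalar product of L^2 then becomes that of H^1. Under this
   identification (I + A(Omega))^-1 f is the orthogonal projection of (f, 0),
   extended by zero, on V(Omega). Since the V(Omega_n) decrease and their
   intersection is V(Omega) up to null sets, the projections on them converge
   strongly, by Pythagoras' theorem. *)

Set Implicit Arguments.
Unset Strict Implicit.
Unset Printing Implicit Defensive.
Import Order.TTheory GRing.Theory Num.Theory.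
Import numFieldNormedType.Exports.
Local Open Scope classical_set_scope.
Local Open Scope ring_scope.

(** * Orthogonal projections on decreasing closed subspaces *)

(** The operators act in spaces that vary with the domain; inside one fixed space, all that varies
    is a closed subspace. Each subspace is presented as the orthogonal complement of explicit test
    families: integration by parts, vanishing off the closure and vanishing divergence are all
    orthogonality relations, so that linearity and closedness follow from general facts.
    Orthogonality of $(f,0)-F$ to V(Omega) reads $\langle f-u,v\rangle=\mathfrak{a}(u,v)$, which is
    the resolvent equation. That the intersection is not too large rests on the definition of
    W(Omega): fields have to vanish almost everywhere off the closure, rather than be limits of test
    fields, and this condition passes to intersections. Null boundaries allow integrals over a
    domain to be taken over all of R^d. Derivatives and resolvents are values of [get], so their
    uniqueness almost everywhere has to be proved: by the fundamental lemma of the calculus of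
    variations for the former, by uniqueness of projections for the latter. *)

Lemma quadratic_ge0_linear_coef {R : realFieldType} (b c : R) : 0 <= c ->
  (forall t, 0 <= t * b *+ 2 + t ^+ 2 * c) -> b = 0.
Proof.
move=> c0 /(_ (- b / (c + 1))).
have c1 : 0 < c + 1 by rewrite ltr_wpDl.
have -> : - b / (c + 1) * b *+ 2 + (- b / (c + 1)) ^+ 2 * c =
    - (b ^+ 2 * ((c + 2) / (c + 1) ^+ 2)).
  by field; rewrite gt_eqF.
rewrite oppr_ge0 pmulr_lle0; last first.
  by rewrite divr_gt0// ?exprn_gt0// ltr_wpDl.
by move=> b0; apply/eqP; rewrite -sqrf_eq0 eq_le b0 sqr_ge0.
Qed.

Section semi_hilbert.
Context {R : realType} {X : lmodType R}.
(** Functions that agree almost everywhere are not identified, so [B] is only positive semidefinite,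
    and limits and projections are unique only up to null vectors of [q]. Linearity is restricted to
    [L] because integrals of products are additive only where they exist. *)
Variables (L : set X) (B : X -> X -> R).
Local Notation q x := (B x x).

Definition cauchy_for (u : nat -> X) := forall e : R, 0 < e ->
  exists N, forall m n, (N <= m)%N -> (N <= n)%N -> q (u m - u n) < e.

Hypothesis L0 : L 0.
Hypothesis L_lin : forall a x y, L x -> L y -> L (a *: x + y).
Hypothesis B_sym : forall x y, B x y = B y x.
Hypothesis B_lin : forall a x y z, L x -> L y -> L z ->
  B (a *: x + y) z = a * B x z + B y z.
Hypothesis B_ge0 : forall x, 0 <= q x.
Hypothesis B_complete : forall u, (forall n, L (u n)) -> cauchy_for u ->
  exists2 x, L x & q (u n - x) @[n --> \oo] --> 0.

Let LZ a x : L x -> L (a *: x).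
Proof. by move=> Lx; rewrite -[_ *: _]addr0; exact: L_lin. Qed.

Let LD x y : L x -> L y -> L (x + y).
Proof. by move=> Lx Ly; rewrite -[x]scale1r; exact: L_lin. Qed.

Let LN x : L x -> L (- x).
Proof. by rewrite -scaleN1r; exact: LZ. Qed.

Let LB x y : L x -> L y -> L (x - y).
Proof. by move=> Lx Ly; apply: LD => //; exact: LN. Qed.


Let B0l z : L z -> B 0 z = 0.
Proof.
move=> Lz; have := B_lin 1 L0 L0 Lz.
by rewrite scaler0 add0r mul1r; lra.
Qed.

Let BZl a x z : L x -> L z -> B (a *: x) z = a * B x z.
Proof. by move=> Lx Lz; rewrite -[_ *: _]addr0 B_lin// B0l// addr0. Qed.

Let BDl x y z : L x -> L y -> L z -> B (x + y) z = B x z + B y z.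
Proof. by move=> Lx Ly Lz; rewrite -[x]scale1r B_lin// scale1r mul1r. Qed.

Let BNl x z : L x -> L z -> B (- x) z = - B x z.
Proof. by move=> Lx Lz; rewrite -scaleN1r BZl// mulN1r. Qed.

Let BBl x y z : L x -> L y -> L z -> B (x - y) z = B x z - B y z.
Proof. by move=> Lx Ly Lz; rewrite BDl ?BNl//; exact: LN. Qed.

Let BZr a x z : L x -> L z -> B z (a *: x) = a * B z x.
Proof. by move=> Lx Lz; rewrite B_sym BZl// B_sym. Qed.

Let BDr x y z : L x -> L y -> L z -> B z (x + y) = B z x + B z y.
Proof. by move=> Lx Ly Lz; rewrite B_sym BDl// !(B_sym z). Qed.

Let BBr x y z : L x -> L y -> L z -> B z (x - y) = B z x - B z y.
Proof. by move=> Lx Ly Lz; rewrite B_sym BBl// !(B_sym z). Qed.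

Let qD x y : L x -> L y -> q (x + y) = q x + B x y *+ 2 + q y.
Proof.
move=> Lx Ly; rewrite BDl ?BDr//; try exact: LD.
by rewrite (B_sym y x); ring.
Qed.

Let qB x y : L x -> L y -> q (x - y) = q x - B x y *+ 2 + q y.
Proof.
move=> Lx Ly; rewrite BBl ?BBr//; try exact: LB.
by rewrite (B_sym y x); ring.
Qed.

Let qZ a x : L x -> q (a *: x) = a ^+ 2 * q x.
Proof. by move=> Lx; rewrite BZl ?BZr//; [rewrite mulrA expr2|exact: LZ]. Qed.

Lemma semi_cauchy_schwarz x y : L x -> L y -> B x y ^+ 2 <= q x * q y.
Proof.
move=> Lx Ly.
have h t : 0 <= q x + t * B x y *+ 2 + t ^+ 2 * q y.
  by rewrite -qZ// -(BZr _ Ly Lx) -qD//; exact: LZ.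
have [y0|y0] := eqVneq (q y) 0.
  have [->|b0] := eqVneq (B x y) 0; first by rewrite y0 expr0n mulr0.
  (* For a null vector [y] the quadratic is affine in [t]; this [t] would give it the value [-1]. *)
  have := h (- (q x + 1) / (B x y *+ 2)).
  rewrite y0 mulr0 addr0.
  have -> : q x + - (q x + 1) / (B x y *+ 2) * B x y *+ 2 = -1.
    by field.
  by rewrite oppr_ge0 ler10.
have := h (- B x y / q y).
have -> : q x + - B x y / q y * B x y *+ 2 + (- B x y / q y) ^+ 2 * q y =
    (q x * q y - B x y ^+ 2) / q y by field.
by rewrite pmulr_lge0 ?subr_ge0// invr_gt0 lt_def y0 B_ge0.
Qed.

Lemma cvg_semi_inner u x z : (forall n, L (u n)) -> L x -> L z ->
  q (u n - x) @[n --> \oo] --> 0 -> B (u n) z @[n --> \oo] --> B x z.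
Proof.
move=> Lu Lx Lz ux; apply/subr_cvg0.
have qz : Num.sqrt (q (u n - x) * q z) @[n --> \oo] --> 0.
  rewrite -[X in _ --> X]sqrtr0 -[X in Num.sqrt X](mul0r (q z)).
  apply: (@cvg_comp _ _ _ _ Num.sqrt _ (nbhs (0 * q z))).
    exact: cvgMr_tmp.
  exact: sqrt_continuous.
apply/norm_cvg0P; apply: squeeze_cvgr qz; last exact: cvg_cst.
apply: nearW => n; rewrite normr_ge0/= -BBl// -sqrtr_sqr ler_sqrt.
  by apply: semi_cauchy_schwarz => //; exact: LB.
by rewrite mulr_ge0.
Qed.

(** A subspace given by the vectors orthogonal to it is linear and closed by construction. *)
Definition ortho_compl (Psi : set X) : set X :=
  [set x | L x /\ forall z, Psi z -> B x z = 0].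

Definition projects_on (M : set X) (x p : X) : Prop :=
  M p /\ forall m, M m -> B (x - p) m = 0.

Section ortho.
Variable Psi : set X.
Hypothesis PsiL : Psi `<=` L.
Local Notation M := (ortho_compl Psi).

Let ML x : M x -> L x. Proof. by case. Qed.

Let M0 : M 0.
Proof. by split=> // z /PsiL; exact: B0l. Qed.

Lemma ortho_compl_lin a x y : M x -> M y -> M (a *: x + y).
Proof.
move=> [Lx Mx] [Ly My]; split=> [|z Pz]; first exact: L_lin.
by rewrite B_lin ?Mx ?My ?mulr0 ?addr0//; exact: PsiL.
Qed.

Let MZ a x : M x -> M (a *: x).
Proof. by move=> Mx; rewrite -[_ *: _]addr0; exact: ortho_compl_lin. Qed.

Let MD x y : M x -> M y -> M (x + y).
Proof. by move=> Mx My; rewrite -[x]scale1r; exact: ortho_compl_lin. Qed.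

Let MB x y : M x -> M y -> M (x - y).
Proof. by move=> Mx My; apply: MD => //; rewrite -scaleN1r; exact: MZ. Qed.

Lemma ortho_compl_closed u x : (forall n, M (u n)) -> L x ->
  q (u n - x) @[n --> \oo] --> 0 -> M x.
Proof.
move=> Mu Lx ux; split=> // z Pz.
have := cvg_semi_inner (fun n => ML (Mu n)) Lx (PsiL Pz) ux.
move=> /(cvg_lim (@Rhausdorff R)) <-; apply/(cvg_lim (@Rhausdorff R)).
by under eq_fun do rewrite (Mu _).2//; exact: cvg_cst.
Qed.

Lemma pythagoras x p m : L x -> projects_on M x p -> M m ->
  q (x - m) = q (x - p) + q (p - m).
Proof.
move=> Lx [Mp xp] Mm.
have -> : x - m = (x - p) + (p - m) by rewrite addrA subrK.
have pm : M (p - m) by exact: MB.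
rewrite qD; [by rewrite (xp _ pm) mul0rn addr0|by apply: LB => //; exact: ML|].
exact: ML.
Qed.

(* Twice the midpoint identity: a minimizing sequence is Cauchy since its
   midpoints stay in the subspace. *)
Let parallelogram x m n : L x -> L m -> L n ->
  q (m - n) = (q (x - m) + q (x - n)) *+ 2 - q (x - 2^-1 *: (m + n)) *+ 4.
Proof.
move=> Lx Lm Ln; have Lmn := LD Lm Ln; have Lh := LZ 2^-1 Lmn.
rewrite !qB// qZ// qD// BZr// BDr//; by field.
Qed.

Lemma projection_exists x : L x -> exists p, projects_on M x p.
Proof.
move=> Lx; pose D := [set q (x - m) | m in M].
have D0 : D !=set0 by exists (q (x - 0)), 0.
have Dge : lbound D 0 by move=> _ [m _ <-].
have infD : has_inf D by split=> //; exists 0.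
pose e n : R := n.+1%:R^-1.
have e0 n : 0 < e n by rewrite invr_gt0.
have /choice[u uP] : forall n, exists m, M m /\ q (x - m) < inf D + e n.
  by move=> n; have [_ [m Mm <-]] := inf_adherent (e0 n) infD; exists m.
have inf_le m : M m -> inf D <= q (x - m).
  by move=> Mm; apply: ge_inf; [exists 0|exists m].
have Lu n : L (u n) := ML (uP n).1.
have uC : cauchy_for u.
  (* By the parallelogram identity [q (u m - u n)] is at most twice the sum of the excesses of the
     two squared distances over [inf D], hence [r / 4]. *)
  move=> r r0; have [N _ NP] := near_infty_natSinv_lt (PosNum (divr_gt0 r0 (ltr0Sn R 3))).
  exists N => m n Nm Nn; rewrite (parallelogram Lx)//.
  have em : e m < r / 4 by exact: NP _ Nm.
  have en : e n < r / 4 by exact: NP _ Nn.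
  have := inf_le _ (MZ 2^-1 (MD (uP m).1 (uP n).1)).
  by have := (uP m).2; have := (uP n).2; lra.
have [p Lp up] := B_complete Lu uC.
have Mp : M p by apply: ortho_compl_closed up => // n; have [] := uP n.
have qp : q (x - p) <= inf D.
  have uxp : q (x - u n) @[n --> \oo] --> q (x - p).
    (* Expanded around [p], so that [u n] enters only through an inner product with a fixed vector
       and through [q (u n - p)], whose limits are known. *)
    have -> : (fun n => q (x - u n)) =
        (fun n => q (x - p) + B (u n) (p - x) *+ 2 - B p (p - x) *+ 2
                  + q (u n - p)).
      apply/funext => n; rewrite !qB// !BBr//.
      by rewrite (B_sym x (u n)) (B_sym x p); ring.
    rewrite -[X in _ --> X]addr0; apply: cvgD => //.
    rewrite -[X in _ --> X](addrK (B p (p - x) *+ 2)).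
    apply: cvgB; last exact: cvg_cst.
    apply: cvgD; first exact: cvg_cst.
    by apply: cvgMn; apply: cvg_semi_inner => //; exact: LB.
  have eS : inf D + e n @[n --> \oo] --> inf D.
    rewrite -[X in _ --> X]addr0; apply: cvgD; first exact: cvg_cst.
    exact: cvg_harmonic.
  rewrite -(cvg_lim (@Rhausdorff R) uxp) -(cvg_lim (@Rhausdorff R) eS).
  apply: ler_lim; [exact: cvgP uxp|exact: cvgP eS|].
  by apply: nearW => n; apply: ltW; have [] := uP n.
(* First variation: moving the minimizer [p] by [t *: m] cannot decrease the squared distance to
   [x]. *)
exists p; split=> // m Mm; apply/eqP; rewrite -oppr_eq0; apply/eqP.
apply: (@quadratic_ge0_linear_coef _ _ (q m)) => // t.
have Lm := ML Mm; have Ltm := LZ t Lm.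
have := inf_le _ (MD Mp (MZ t Mm)); rewrite opprD addrA => /(le_trans qp).
rewrite [in leRHS]qB//; last exact: LB.
rewrite BZr//; last exact: LB.
by rewrite qZ//; lra.
Qed.

Lemma projection_unique x p p' : L x -> projects_on M x p ->
  projects_on M x p' -> q (p - p') = 0.
Proof.
move=> Lx xp xp'; have [Mp _] := xp; have [Mp' _] := xp'.
have := pythagoras Lx xp Mp'; have := pythagoras Lx xp' Mp.
have := B_ge0 (p - p').
have : q (p - p') = q (p' - p) by rewrite !qB//; [rewrite B_sym; ring|exact: ML..].
lra.
Qed.

End ortho.

(* Pythagoras makes the squared distances to the decreasing subspaces a bounded
   nondecreasing sequence and turns its increments into the squared distances
   between the projections. *)
Lemma projection_cvg (Psi_ : nat -> set X) (Psi : set X) x p_ p :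
  (forall n, Psi_ n `<=` L) -> Psi `<=` L ->
  (forall n, ortho_compl (Psi_ n.+1) `<=` ortho_compl (Psi_ n)) ->
  (forall n, ortho_compl Psi `<=` ortho_compl (Psi_ n)) ->
  \bigcap_n ortho_compl (Psi_ n) `<=` ortho_compl Psi ->
  L x -> (forall n, projects_on (ortho_compl (Psi_ n)) x (p_ n)) ->
  projects_on (ortho_compl Psi) x p ->
  q (p_ n - p) @[n --> \oo] --> 0.
Proof.
move=> PL_ PL Mdec MsubM capM Lx xp_ xp.
have Mle m n : (m <= n)%N -> ortho_compl (Psi_ n) `<=` ortho_compl (Psi_ m).
  move=> /subnK <-; elim: (n - m)%N => [//|k IH].
  by rewrite addSn; exact: subset_trans (Mdec _) IH.
have Mp_ n : ortho_compl (Psi_ n) (p_ n) := (xp_ n).1.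
have Lp_ n : L (p_ n) := (Mp_ n).1.
have Lp : L p := xp.1.1.
pose d n := q (x - p_ n).
have dE m n : (m <= n)%N -> q (p_ m - p_ n) = d n - d m.
  move=> mn; rewrite /d (pythagoras (PL_ m) Lx (xp_ m) (Mle _ _ mn _ (Mp_ n))).
  by rewrite addrAC subrr add0r.
have dnd : nondecreasing_seq d.
  by move=> m n mn; rewrite -subr_ge0 -dE.
have dub n : d n <= q (x - p).
  rewrite (pythagoras (PL_ n) Lx (xp_ n) (MsubM n _ xp.1)).
  by rewrite lerDl.
have dcvg : cvgn d.
  by apply: nondecreasing_is_cvgn => //; exists (q (x - p)) => _ [n _ <-].
have dlim n : d n <= limn d by exact: nondecreasing_cvgn_le.
have pC : cauchy_for p_.
  move=> r r0; have /cvgrPdist_lt/(_ _ r0)[N _ NP] := dcvg.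
  exists N => m n; wlog mn : m n / (m <= n)%N => [hw Nm Nn|Nm Nn].
    have [mn|/ltnW nm] := leqP m n; first exact: hw.
    rewrite (_ : q _ = q (p_ n - p_ m)); first exact: hw.
    by rewrite !qB//; rewrite B_sym; ring.
  rewrite dE//; have := NP _ Nm => /=; have := dlim n; have := dlim m.
  by move=> dm dn; rewrite ger0_norm ?subr_ge0//; lra.
have [p' Lp' pp'] := B_complete Lp_ pC.
(* From index [n] on the projections stay in the [n]-th subspace, which is closed; so the limit lies
   in all of them. *)
have Mp' : ortho_compl Psi p'.
  apply: capM => n _.
  apply: (@ortho_compl_closed _ (PL_ n) (fun k : nat => p_ (k + n)%N)) => //.
    by move=> k; apply: Mle (Mp_ _); rewrite leq_addl.
  by rewrite -(cvg_shiftn n (fun k => q (p_ k - p'))) in pp'.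
have xp' : projects_on (ortho_compl Psi) x p'.
  split=> // m Mm; have Lm := Mm.1.
  have := cvg_semi_inner Lp_ Lp' Lm pp' => /(cvg_lim (@Rhausdorff R)) pm.
  rewrite BBl// -pm; under eq_fun => n.
    rewrite (_ : B (p_ n) m = B x m); first over.
    by have := (xp_ n).2 _ (MsubM n _ Mm); rewrite BBl// => /subr0_eq.
  by rewrite lim_cst ?subrr//; exact: Rhausdorff.
have p'p : q (p' - p) = 0 by exact: projection_unique xp' xp.
have Lp'p := LB Lp' Lp.
(* By Cauchy-Schwarz a null vector is orthogonal to all of [L], so that [p] can replace [p'] in the
   limit. *)
have p'p0 z : L z -> B z (p' - p) = 0.
  move=> Lz; have := semi_cauchy_schwarz Lz Lp'p; rewrite p'p mulr0 => h.
  by apply/eqP; rewrite -sqrf_eq0 eq_le h sqr_ge0.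
suff -> : (fun n => q (p_ n - p)) = (fun n => q (p_ n - p')) by [].
apply/funext => n; have Ln := LB (Lp_ n) Lp'.
have -> : p_ n - p = (p_ n - p') + (p' - p) by rewrite addrA subrK.
by rewrite (qD Ln Lp'p) p'p p'p0// mul0rn !addr0.
Qed.

End semi_hilbert.

(** * The space L^2 of a measure *)

Section L2_space.
Context d (T : measurableType d) (R : realType).
Variable mu : {measure set T -> \bar R}.
Implicit Types (f g h : T -> R).

Lemma Lfun2P f : f \in Lfun mu 2%:E <->
  measurable_fun setT f /\ (\int[mu]_x (f x ^+ 2)%:E < +oo)%E.
Proof.
split=> [f2|[mf fi]].
  split; first by move: f2; rewrite inE => /andP[/[!inE]].
  have /integrableP[_] := Lfun2_integrable_sqr f2.
  apply: le_lt_trans; rewrite le_eqVlt; apply/orP; left; apply/eqP.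
  by apply: eq_integral => x _ /=; rewrite ger0_norm ?sqr_ge0.
rewrite inE; apply/andP; split; rewrite inE//=.
rewrite /finite_norm unlock poweR_lty//.
by under eq_integral do rewrite /= powR_mulrn// real_normK ?num_real//.
Qed.

Lemma Lfun2_lin a f g : f \in Lfun mu 2%:E -> g \in Lfun mu 2%:E ->
  (fun x => a * f x + g x) \in Lfun mu 2%:E.
Proof. by move=> f2 g2; have [_] := Lfun_submod_closed mu (lee1n 2); exact. Qed.

Lemma Lfun2_0 : (fun _ : T => 0 : R) \in Lfun mu 2%:E.
Proof. by have [] := Lfun_submod_closed mu (lee1n 2). Qed.

Lemma Lfun2B f g : f \in Lfun mu 2%:E -> g \in Lfun mu 2%:E ->
  (fun x => f x - g x) \in Lfun mu 2%:E.
Proof.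
move=> f2 g2; rewrite (_ : (fun _ => _) = (fun x => -1 * g x + f x)).
  exact: Lfun2_lin.
by apply/funext => x; rewrite mulN1r addrC.
Qed.

Lemma Lfun2_sum (I : Type) (s : seq I) (F : I -> T -> R) :
  (forall i, F i \in Lfun mu 2%:E) ->
  (fun x => \sum_(i <- s) F i x) \in Lfun mu 2%:E.
Proof.
move=> F2; elim: s => [|i s IH].
  by under eq_fun do rewrite big_nil; exact: Lfun2_0.
under eq_fun do rewrite big_cons -[X in X + _]mul1r.
exact: Lfun2_lin.
Qed.

Lemma integrable_Lfun2M f g : f \in Lfun mu 2%:E -> g \in Lfun mu 2%:E ->
  mu.-integrable setT (EFin \o (fun x => f x * g x)).
Proof. by move=> f2 g2; apply/Lfun1_integrable; exact: Lfun2_mul_Lfun1. Qed.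

Lemma Lfun2_fin f : f \in Lfun mu 2%:E ->
  (\int[mu]_x (f x ^+ 2)%:E)%E = (\int[mu]_x (f x * f x))%:E.
Proof.
move=> f2; rewrite /Rintegral fineK//.
have /Lfun2P[_ foo] := f2; rewrite ge0_fin_numE//.
by apply: integral_ge0 => x _; rewrite lee_fin sqr_ge0.
Qed.

Lemma Rintegral_sqr_eq0 f : f \in Lfun mu 2%:E ->
  \int[mu]_x (f x * f x) = 0 -> ae_eq mu setT f (cst 0).
Proof.
move=> f2 f0; have /Lfun2P[mf _] := f2.
have mff : measurable_fun setT (fun x => (f x ^+ 2)%:E).
  by apply/measurable_EFinP; exact: measurable_funX.
have /(ae_eq_integral_abs mu measurableT mff).1 :
    (\int[mu]_x `|(f x ^+ 2)%:E| = 0)%E.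
  under eq_integral do rewrite gee0_abs ?lee_fin ?sqr_ge0//.
  by rewrite Lfun2_fin// f0.
apply: filterS => x /(_ I) [] /eqP; rewrite sqrf_eq0 => /eqP fx _.
exact: fx.
Qed.

Section completeness.
Variable u : nat -> T -> R.
Hypothesis u2 : forall n, u n \in Lfun mu 2%:E.
Hypothesis uC : forall e : R, 0 < e -> exists N, forall m n,
  (N <= m)%N -> (N <= n)%N ->
  \int[mu]_x ((u m x - u n x) * (u m x - u n x)) < e.

Let u2B m n : (fun x => u m x - u n x) \in Lfun mu 2%:E.
Proof. exact: Lfun2B. Qed.

Let mu_ n : measurable_fun setT (u n).
Proof. by have /Lfun2P[] := u2 n. Qed.

(* Along a subsequence with squared distances at most [8 ^- k], the weighted sum
   of the [4 ^+ k * (increment k) ^+ 2] is integrable, hence the increments are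
   almost everywhere bounded by a geometric sequence. *)
Let subseq_ae_cvg : exists phi : nat -> nat, (forall k, (k <= phi k)%N) /\
  {ae mu, forall x, cvgn (fun k => u (phi k) x)}.
Proof.
have e0 k : (0 : R) < 8 ^- k by rewrite invr_gt0 exprn_gt0.
have /choice[N NP] : forall k, exists N, forall m n,
    (N <= m)%N -> (N <= n)%N ->
    \int[mu]_x ((u m x - u n x) * (u m x - u n x)) < 8 ^- k.
  by move=> k; exact: uC (e0 k).
(* Summing the successors makes [phi] increasing and at least both [N k] and [k]. *)
pose phi k := (\sum_(j < k.+1) (N j).+1)%N.
have phiS k : (phi k <= phi k.+1)%N by rewrite /phi [leqRHS]big_ord_recr leq_addr.
have Nphi k : (N k <= phi k)%N.
  by rewrite /phi big_ord_recr/= (leq_trans (leqnSn _))// leq_addl.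
exists phi; split.
  move=> k; rewrite /phi; apply: (@leq_trans (\sum_(j < k.+1) 1)%N).
    by rewrite sum1_card card_ord.
  by apply: leq_sum.
pose D k x : R := u (phi k.+1) x - u (phi k) x.
have mD k : measurable_fun setT (D k) by exact: measurable_funB.
pose g k x : \bar R := (4 ^+ k * D k x ^+ 2)%:E.
have mg k : measurable_fun setT (g k).
  by apply/measurable_EFinP; apply: measurable_funM => //; exact: measurable_funX.
have g0 k x : (0 <= g k x)%E.
  by rewrite lee_fin mulr_ge0 ?sqr_ge0// exprn_ge0.
have Ig k : (\int[mu]_x g k x <= (1 / 2 ^+ k)%:E)%E.
  rewrite /g; under eq_integral do rewrite EFinM.
  have mD2 : measurable_fun setT (fun x => (D k x ^+ 2)%:E).
    by apply/measurable_EFinP; exact: measurable_funX.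
  have D20 x : setT x -> (0 <= (D k x ^+ 2)%:E)%E by rewrite lee_fin sqr_ge0.
  have e4 : 0 <= 4 ^+ k :> R by rewrite exprn_ge0.
  rewrite ge0_integralZl_EFin//.
  rewrite (Lfun2_fin (u2B _ _)) -EFinM lee_fin.
  rewrite (_ : 1 / 2 ^+ k = 4 ^+ k * 8 ^- k); last first.
    have -> : (8 : R) = 4 * 2 by rewrite -natrM.
    rewrite exprMn; field.
    by apply/andP; split; rewrite expf_neq0.
  rewrite ler_pM2l ?exprn_gt0//; apply: ltW; apply: NP => //.
  exact: leq_trans (Nphi _) (phiS _).
have S_fin : (\int[mu]_x (\sum_(k <oo) g k x) < +oo)%E.
  rewrite integral_nneseries//.
  apply: (@le_lt_trans _ _ (\sum_(k <oo) (1 / 2 ^+ k)%:E)%E).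
    by apply: lee_nneseries => [k _ _|k _]; [apply: integral_ge0|exact: Ig].
  apply: (@le_lt_trans _ _ 2%:E); last exact: ltry.
  have := @epsilon_trick0 R 2 xpredT (ler0n _ _); apply: le_trans.
  rewrite le_eqVlt; apply/orP; left; apply/eqP; apply: eq_eseriesr => k _.
  by congr EFin; rewrite natrX exprS; field; rewrite expf_neq0.
have S0 x : (0 <= \sum_(k <oo) g k x)%E by exact: nneseries_ge0.
have mS : measurable_fun setT (fun x => \sum_(k <oo) g k x)%E.
  exact: ge0_emeasurable_sum.
have iS : mu.-integrable setT (fun x => \sum_(k <oo) g k x)%E.
  apply/integrableP; split=> //.
  by under eq_integral do rewrite gee0_abs//.
apply: filterS (integrable_ae measurableT iS) => x /(_ I) Sx.
set s := fine (\sum_(k <oo) g k x)%E.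
have gs k : 4 ^+ k * D k x ^+ 2 <= s.
  rewrite -lee_fin /s fineK//.
  apply: le_trans (nneseries_lim_ge k.+1 _) => //.
  rewrite big_mkord big_ord_recr/= -[leLHS]add0e leeD//.
  by apply: sume_ge0.
have Ds k : `|D k x| <= Num.sqrt s * 2^-1 ^+ k.
  rewrite -sqrtr_sqr exprVn -[X in _ <= _ / X]ger0_norm ?exprn_ge0//.
  rewrite -sqrtr_sqr -sqrtrV ?sqr_ge0// -sqrtrM; last first.
    exact: le_trans (mulr_ge0 (exprn_ge0 0 (ler0n _ _)) (sqr_ge0 (D 0%N x))) (gs 0%N).
  apply: ler_wsqrtr; rewrite ler_pdivlMr ?exprn_gt0// mulrC.
  have -> : (2 ^+ k) ^+ 2 = 4 ^+ k :> R.
    by rewrite exprAC; congr (_ ^+ _); rewrite -natrX.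
  exact: gs.
have vE : (fun k => u (phi k) x) =
    (fun k => u (phi 0%N) x + series (fun k => D k x) k).
  by apply/funext => k; rewrite [LHS](eq_sum_telescope (fun k => u (phi k) x)).
rewrite vE; apply: is_cvgD; first exact: is_cvg_cst.
apply: normed_cvg; apply: (@series_le_cvg _ _ (geometric (Num.sqrt s) 2^-1)).
- by move=> n /=.
- by move=> n /=; rewrite mulr_ge0 ?sqrtr_ge0// exprn_ge0.
- by move=> n /=; exact: Ds.
- apply: is_cvg_geometric_series.
  by rewrite ger0_norm// invf_lt1// ltr1n.
Qed.

Lemma Lfun2_complete : exists2 f, f \in Lfun mu 2%:E &
  \int[mu]_x ((u n x - f x) * (u n x - f x)) @[n --> \oo] --> 0.
Proof.
have [phi [phi_ge u_cvg]] := subseq_ae_cvg.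
(* An upper limit is measurable and defined everywhere, and is the limit wherever there is a finite
   one. *)
pose f x := fine (limn_esup (fun k => (u (phi k) x)%:E)).
have mf : measurable_fun setT f.
  apply: measurableT_comp => //; apply: measurable_fun_limn_esup => k.
  exact/measurable_EFinP.
have uf : {ae mu, forall x, u (phi k) x @[k --> \oo] --> f x}.
  apply: filterS u_cvg => x ux.
  have uE : (u (phi k) x)%:E @[k --> \oo] --> (limn (fun k => u (phi k) x))%:E.
    by apply: cvg_EFin => //; exact: nearW.
  by rewrite /f (cvg_limn_einf_sup uE).2.
(* Fatou's lemma in the index of the subsequence, with [n] fixed, turns the Cauchy estimate into an
   estimate of the distance to [f]. *)
have Iuf e : 0 < e -> exists N, forall n, (N <= n)%N ->
    (\int[mu]_x ((u n x - f x) ^+ 2)%:E <= e%:E)%E.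
  move=> e0; have [N NP] := uC e0; exists N => n Nn.
  pose h k x : \bar R := ((u n x - u (phi k) x) ^+ 2)%:E.
  have mh k : measurable_fun setT (h k).
    apply/measurable_EFinP; apply: measurable_funX.
    exact: measurable_funB.
  rewrite (@ge0_ae_eq_integral _ _ _ _ _ _ (fun x => limn_einf (h ^~ x)))//.
  - apply: le_trans (fatou _ _ _ _) _ => //.
      by move=> k x _; rewrite lee_fin sqr_ge0.
    rewrite limn_einf_lim; apply: lime_le; first exact: is_cvg_einfs.
    (* The infimum over the indices from [m] on is bounded by its term at [maxn m N], where the
       Cauchy estimate applies. *)
    apply: nearW => m; apply: (@le_trans _ _ (\int[mu]_x h (maxn m N) x)%E).
      by apply: ereal_inf_lbound; exists (maxn m N) => //=; exact: leq_maxl.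
    rewrite (Lfun2_fin (u2B _ _)) lee_fin; apply: ltW; apply: NP => //.
    exact: leq_trans (leq_maxr _ _) (phi_ge _).
  - apply/measurable_EFinP; apply: measurable_funX.
    exact: measurable_funB.
  - rewrite (_ : (fun _ => _) = (fun x => - limn_esup (fun k => - h k x)))%E//.
    apply: measurableT_comp => //; apply: measurable_fun_limn_esup => k.
    exact: measurableT_comp.
  - by move=> x _; rewrite lee_fin sqr_ge0.
  - move=> x _; rewrite limn_einf_lim; apply: lime_ge.
      exact: is_cvg_einfs.
    apply: nearW => m; apply: le_ereal_inf_tmp => _ [k _ <-].
    by rewrite lee_fin sqr_ge0.
  - apply: filterS uf => x ux _.
    have hx : h ^~ x @ \oo --> ((u n x - f x) ^+ 2)%:E.
      apply: cvg_EFin; first exact: nearW.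
      rewrite expr2; apply: cvgM; apply: cvgB => //; exact: cvg_cst.
    by rewrite (cvg_limn_einf_sup hx).1.
have Lu : exists N, forall n, (N <= n)%N -> (fun x => u n x - f x) \in Lfun mu 2%:E.
  have [N NP] := Iuf _ ltr01; exists N => k Nk.
  apply/Lfun2P; split; first exact: measurable_funB.
  by apply: le_lt_trans (NP _ Nk) _; exact: ltry.
have f2 : f \in Lfun mu 2%:E.
  have [N NP] := Lu.
  have := Lfun2B (u2 N) (NP _ (leqnn _)).
  by rewrite (_ : (fun _ => _) = f)//; apply/funext => x; rewrite opprB addrC subrK.
exists f => //; apply/cvgrPdist_le => e e0; have [N NP] := Iuf _ e0.
exists N => // n /= Nn; rewrite sub0r normrN ger0_norm; last first.
  by apply: Rintegral_ge0 => x _; rewrite -expr2 sqr_ge0.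
by rewrite -lee_fin -Lfun2_fin ?NP//; exact: Lfun2B.
Qed.

End completeness.

End L2_space.

(** * Lebesgue measure on R^d *)

Section lebesgue_rV.
Context {R : realType} {d : nat}.
Local Notation Rd := 'rV[R]_d.
Implicit Types (A O : set Rd) (ab : Rd * Rd).

Lemma lebesgue_outer_cover_le (P : pred nat) (F : nat -> Rd * Rd) A :
  A `<=` \bigcup_(k in [set k | P k]) box (F k) ->
  (lebesgue_outer A <= \sum_(k <oo | P k) box_volume (F k))%E.
Proof. by move=> AF; apply: ereal_inf_lbound; exists P, F; split. Qed.

Lemma lebesgue_box_le ab : (lebesgue (box ab) <= box_volume ab)%E.
Proof.
apply: le_trans (@lebesgue_outer_cover_le (pred1 0%N) (fun=> ab) _ _) _.
  by move=> x xab; exists 0%N => //=.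
rewrite eseries_mkcond (@nneseries_split _ _ 0 1)//; last first.
  by move=> k _; case: ifP => // _; exact: box_volume_ge0.
rewrite add0n big_nat1/= eseries0 ?adde0// => k k1 _ /=.
by case: k k1.
Qed.

Lemma lebesgue_box_fin ab : (lebesgue (box ab) < +oo)%E.
Proof. by apply: le_lt_trans (lebesgue_box_le ab) _; exact: ltry. Qed.

Definition box_above (i : 'I_d) (c : R) (ab : Rd * Rd) : Rd * Rd :=
  (\row_j if j == i then Num.max (ab.1 0 j) c else ab.1 0 j, ab.2).

Definition box_below (i : 'I_d) (c : R) (ab : Rd * Rd) : Rd * Rd :=
  (ab.1, \row_j if j == i then Num.min (ab.2 0 j) c else ab.2 0 j).

Lemma box_aboveE i c ab :
  box (box_above i c ab) = box ab `&` [set x | c < x 0 i].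
Proof.
apply/seteqP; split=> [x xab|x [xab cx] j] /=.
  split=> [j|].
    have := xab j => /=; rewrite mxE.
    by case: ifP => // _ /andP[+ ->]; rewrite gt_max => /andP[->].
  by have := xab i => /=; rewrite mxE eqxx gt_max => /andP[/andP[]].
by rewrite mxE; case: ifP => [/eqP ->|_]; [rewrite gt_max cx andbT|]; exact: xab.
Qed.

Lemma box_belowE i c ab :
  box (box_below i c ab) = box ab `&` ~` [set x | c < x 0 i].
Proof.
apply/seteqP; split=> [x xab|x [xab /negP]] /=.
  split=> [j|].
    have := xab j => /=; rewrite mxE.
    by case: ifP => // _ /andP[->]; rewrite le_min => /andP[->].
  have := xab i => /=; rewrite mxE eqxx le_min => /andP[_ /andP[_]].
  by rewrite leNgt => /negP.
rewrite -leNgt => cx j /=; rewrite mxE; case: ifP => [/eqP ->|_].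
  by rewrite le_min cx andbT; exact: xab.
exact: xab.
Qed.

(** This holds even when the hyperplane misses the box, since [box_volume] counts negative side
    lengths as 0. *)
Lemma box_volume_split i c ab : (box_volume (box_above i c ab) +
  box_volume (box_below i c ab) = box_volume ab)%E.
Proof.
rewrite /box_volume -EFinD; congr EFin.
rewrite (bigD1 i)//= [X in _ + X](bigD1 i)//= [RHS](bigD1 i)//=.
under eq_bigr => j /negPf ji do rewrite mxE ji.
under [X in _ + _ * X]eq_bigr => j /negPf ji do rewrite mxE ji.
rewrite -mulrDl !mxE eqxx; congr (_ * _).
rewrite !maxEle !minEle.
by repeat case: ifPn; rewrite -?ltNge; lra.
Qed.

(** Caratheodory's criterion: cutting every box of a cover along the hyperplane yields covers of the
    two pieces with the same total volume. *)
Lemma measurable_half_space (i : 'I_d) (c : R) :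
  measurable [set x : Rd | c < x 0 i].
Proof.
apply: (@le_caratheodory_measurable R _ lebesgue_outer) => X.
apply: le_ereal_inf_tmp => _ [P [F [_ XF ->]]].
apply: (@le_trans _ _ (\sum_(k <oo | P k) box_volume (box_above i c (F k)) +
                       \sum_(k <oo | P k) box_volume (box_below i c (F k)))%E).
  apply: leeD; apply: lebesgue_outer_cover_le => x [Xx cx];
    have [k Pk xk] := XF _ Xx; exists k => //.
    by rewrite box_aboveE.
  by rewrite box_belowE.
rewrite -nneseriesD; try by move=> *; exact: box_volume_ge0.
by under eq_eseriesr do rewrite box_volume_split.
Qed.

Lemma measurable_coord (i : 'I_d) : measurable_fun setT (fun x : Rd => x 0 i).
Proof.
apply: (measurability _ (RGenOInfty.measurableE R)) => _ [_ [c ->] <-].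
rewrite setTI (_ : _ @^-1` _ = [set x : Rd | c < x 0 i]).
  exact: measurable_half_space.
by apply/seteqP; split => x /=; rewrite in_itv/= andbT.
Qed.

Lemma measurable_box ab : measurable (box ab).
Proof.
rewrite (_ : box ab = \bigcap_(i in [set: 'I_d])
  ((fun x : Rd => x 0 i) @^-1` `]ab.1 0 i, ab.2 0 i])).
  apply: fin_bigcap_measurable => // i _.
  by rewrite -[X in measurable X]setTI; exact: measurable_coord.
apply/seteqP; split=> x /=.
  by move=> xab i _ /=; rewrite in_itv/=; exact: xab.
by move=> xab i; have := xab i I; rewrite /= in_itv.
Qed.

Definition cube (c : Rd) (r : R) : set Rd :=
  box (\row_j (c 0 j - r), \row_j (c 0 j + r)).

Lemma cubeP c r x : cube c r x <-> forall i, c 0 i - r < x 0 i <= c 0 i + r.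
Proof.
by split=> h i; have := h i; rewrite /= !mxE.
Qed.

Lemma measurable_cube c r : measurable (cube c r).
Proof. exact: measurable_box. Qed.

Definition rat_cube (p : 'rV[rat]_d * nat) : set Rd :=
  cube (map_mx ratr p.1) p.2.+1%:R^-1.

(** A whole ball of twice the radius, not just the cube, has to fit into [O]: this leaves room for
    test functions on [O] that approximate indicators of boxes inside the cube. *)
Lemma open_rat_cubes O : open O ->
  O = \bigcup_(p in [set p : 'rV[rat]_d * nat |
        ball (map_mx ratr p.1 : Rd) (p.2.+1%:R^-1 *+ 2) `<=` O]) rat_cube p.
Proof.
move=> oO; apply/seteqP; split=> [x Ox|x [[c n] /= h /cubeP xc]]; last first.
  have n0 : 0 < n.+1%:R^-1 :> R by [].
  apply: h; split=> [|i j]; first by rewrite mulr2n addr_gt0.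
  rewrite (ord1 i) /ball/= mxE ltr_norml; have := xc j; rewrite mxE /=.
  by move: (n.+1%:R^-1) n0 => r n0; lra.
have /nbhs_ballP[e /= e0 xe] : nbhs x O by exact: open_nbhs_nbhs.
(* A point within [2 * r] of a centre that is itself within [r] of [x] stays within [3 * r] of [x],
   hence [e / 3]. *)
have [n _ /(_ n (leqnn n)) ne] :=
  near_infty_natSinv_lt (PosNum (divr_gt0 e0 (ltr0Sn R 2))).
have [r rE] : exists r : R, n.+1%:R^-1 = r by exists n.+1%:R^-1.
have r0 : 0 < r by rewrite -rE.
have {}ne : r < e / 3 by rewrite -rE; exact: ne.
have /choice[c cP] : forall j : 'I_d, exists q : rat,
    x 0 j - r < ratr q < x 0 j + r.
  move=> j; have [|q] := @rat_in_itvoo R (x 0 j - r) (x 0 j + r); first by lra.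
  by rewrite in_itv/=; exists q.
exists (\row_j c j, n) => /=.
  move=> y [_ yc]; apply: xe; split=> // i j; rewrite (ord1 i) /ball/=.
  have := yc 0 j; rewrite /ball/= !mxE rE; have := cP j.
  by rewrite !ltr_norml; lra.
by apply/cubeP => j; rewrite !mxE /= rE; have := cP j; lra.
Qed.

Lemma measurable_open O : open O -> measurable O.
Proof.
move=> /open_rat_cubes ->; rewrite bigcup_mkcond.
apply: countable_bigcupT_measurable => [|p]; first exact: countableP.
by case: ifP => // _; exact: measurable_cube.
Qed.

Lemma measurable_continuous (f : Rd -> R) : continuous f -> measurable_fun setT f.
Proof.
move=> /continuousP cf.
apply: (measurability _ (RGenOpens.measurableE R)) => _ [_ [a [b ->] <-]].
by rewrite setTI; apply: measurable_open; apply: cf; exact: interval_open.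
Qed.

Lemma lebesgue_complete : measure_is_complete (@lebesgue R d).
Proof. exact: (@measure_is_complete_caratheodory R _ lebesgue_outer). Qed.

Lemma bounded_sub_cube A : bounded_set A -> exists r, A `<=` cube 0 r.
Proof.
move=> [M [_ /(_ (M + 1))]]; rewrite ltrDl ltr01 => /(_ isT) AM.
exists (M + 2) => x /AM /= xM; apply/cubeP => i; rewrite mxE.
have : `|x 0 i| <= M + 1.
  apply: le_trans xM; rewrite [leRHS]mx_normrE.
  exact: (le_bigmax _ (fun ij : 'I_1 * 'I_d => `|x ij.1 ij.2|) (0, i)).
by rewrite ler_norml; lra.
Qed.

Lemma bounded_fin A : bounded_set A -> (lebesgue A < +oo)%E.
Proof.
move=> /bounded_sub_cube[r Ar]; apply: le_lt_trans (lebesgue_box_fin _).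
exact: (le_outer_measure lebesgue_outer _ _ Ar).
Qed.

(** * Null sets of the Hausdorff measure *)

Lemma coord_le_enorm (x : Rd) i : `|x 0 i| <= enorm x.
Proof.
rewrite -sqrtr_sqr; apply: ler_wsqrtr.
rewrite /dotr (bigD1 i)//= -expr2 lerDl.
by apply: sumr_ge0 => j _; rewrite -expr2 sqr_ge0.
Qed.

Lemma cube_volume (c : Rd) (r : R) : 0 <= r ->
  box_volume (\row_j (c 0 j - r), \row_j (c 0 j + r)) = ((2 * r) ^+ d)%:E.
Proof.
move=> r0; congr EFin; rewrite (eq_bigr (fun=> 2 * r)).
  by rewrite prodr_const card_ord.
by move=> i _ /=; rewrite !mxE max_r; lra.
Qed.

Lemma exprn_right_cont (a e : R) (n : nat) : 0 < e ->
  exists2 b, a < b & b ^+ n < a ^+ n + e.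
Proof.
move=> e0.
have : (t ^+ n) @[t --> a^'+] --> a ^+ n.
  by apply: cvg_at_right_filter; exact: exprn_continuous.
move=> /cvgrPdist_lt/(_ _ e0) h.
near a^'+ => b; exists b; first by near: b; exact: nbhs_right_gt.
have : `|a ^+ n - b ^+ n| < e by near: b.
by rewrite ltr_norml; lra.
Unshelve. all: by end_near. Qed.

Lemma ediam_cube (E : set Rd) x (b : R) : E x -> (ediam E < b%:E)%E ->
  E `<=` cube x b.
Proof.
move=> Ex Eb y Ey; apply/cubeP => i.
have yx : ((enorm (y - x))%:E <= ediam E)%E.
  by apply: ereal_sup_ubound; exists (y, x).
have := le_lt_trans yx Eb; rewrite lte_fin.
move=> /(le_lt_trans (coord_le_enorm _ i)); rewrite !mxE ltr_norml; lra.
Qed.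

Lemma ediam_ge0 (E : set Rd) : E !=set0 -> (0 <= ediam E)%E.
Proof.
move=> [x Ex]; apply: (@le_trans _ _ (enorm (x - x))%:E).
  by rewrite lee_fin sqrtr_ge0.
by apply: ereal_sup_ubound; exists (x, x).
Qed.

(** A set of diameter less than [b] lies in the cube of half-side [b] around any of its points, of
    volume $(2b)^d$. Thus a Hausdorff cover becomes a cover by boxes at the price of a factor $2^d$;
    the scale 1 ensures that all diameters are finite. *)
Lemma hausdorff_null_lebesgue A : hausdorff A = 0%E -> lebesgue A = 0%E.
Proof.
move=> A0; apply/eqP; rewrite eq_le outer_measure_ge0 andbT.
have preA : (hausdorff_pre 1 A <= 0)%E.
  by rewrite -A0; apply: ereal_sup_ubound; exists 1 => //=; exact: ltr01.
apply/lee_addgt0Pr => e e0; rewrite add0e.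
(* The factor [2 ^+ d] compensates the volume of the cubes; the other 2 shares [e] between the
   Hausdorff sum and the enlargements of the cubes. *)
pose e' := e / (2 ^+ d * 2).
have e'0 : 0 < e' by rewrite divr_gt0// mulr_gt0// exprn_gt0.
have {}preA : (hausdorff_pre 1 A < e'%:E)%E.
  by apply: le_lt_trans preA _; rewrite lte_fin.
have [_ [P [F [DF AF ->]]] Fe] := ereal_inf_lt preA.
(* The half-side exceeds the diameter strictly because cubes are half-open; the excess in the [d]-th
   power is summable over [k]. *)
have /choice[b bP] : forall k, exists b : R, P k -> exists c,
    F k `<=` cube c b /\ 0 <= b /\
    ((b ^+ d)%:E <= ediam (F k) ^+ d + (e' / (2 ^ k.+1)%:R)%:E)%E.
  move=> k; have [Pk|] := boolP (P k); last by exists 0.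
  have [[x Fx] F1] := DF _ Pk.
  have F0 : (0 <= ediam (F k))%E by apply: ediam_ge0; exists x.
  have Ffin : ediam (F k) \is a fin_num.
    by rewrite ge0_fin_numE//; apply: le_lt_trans F1 _; exact: ltry.
  have ek : 0 < e' / (2 ^ k.+1)%:R by rewrite divr_gt0// ltr0n expn_gt0.
  have [b ab bd] := exprn_right_cont (fine (ediam (F k))) d ek.
  exists b => _; exists x; split; [|split].
  - by apply: ediam_cube => //; rewrite -(fineK Ffin) lte_fin.
  - by apply: le_trans (ltW ab); rewrite fine_ge0.
  - by rewrite -(fineK Ffin) -EFin_expe -EFinD lee_fin ltW.
have /choice[c cP] : forall k, exists c, P k -> F k `<=` cube c (b k).
  move=> k; have [Pk|] := boolP (P k); last by exists 0.
  by have [c [? _]] := bP _ Pk; exists c.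
pose Q k := (\row_j (c k 0 j - b k), \row_j (c k 0 j + b k)) : Rd * Rd.
apply: le_trans (@lebesgue_outer_cover_le P Q A _) _.
  by move=> x /AF[k Pk Fx]; exists k => //; exact: cP Fx.
apply: (@le_trans _ _ (\sum_(k <oo | P k) ((2 ^+ d)%:E *
   (ediam (F k) ^+ d + (e' / (2 ^ k.+1)%:R)%:E)))%E).
  apply: lee_nneseries => [k _ _|k Pk]; first exact: box_volume_ge0.
  have [_ [_ [b0 bd]]] := bP _ Pk.
  apply: le_trans (_ : ((2 ^+ d)%:E * (b k ^+ d)%:E <= _)%E); last first.
    by rewrite lee_pmul2l// lte_fin exprn_gt0.
  by rewrite cube_volume// exprMn EFinM.
have F0 k : P k -> (0 <= ediam (F k) ^+ d)%E.
  by move=> /DF[F0 _]; apply: expe_ge0; exact: ediam_ge0.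
have ek0 k : (0 <= (e' / (2 ^ k.+1)%:R)%:E)%E by rewrite lee_fin divr_ge0 ?ltW.
rewrite nneseriesZl; last by move=> k Pk; apply: adde_ge0; [exact: F0|].
rewrite nneseriesD//; last by move=> k _; exact: F0.
have -> : e%:E = ((2 ^+ d)%:E * (e'%:E + e'%:E))%E.
  rewrite -EFinD -EFinM; congr EFin; rewrite /e'; field.
  by rewrite expf_neq0.
rewrite lee_pmul2l// ?lte_fin ?exprn_gt0//.
apply: leeD; first exact: ltW.
by apply: epsilon_trick0; exact: ltW.
Qed.

Lemma lebesgue_null_measurable A : lebesgue A = 0%E -> measurable A.
Proof.
move=> A0; apply: (@le_caratheodory_measurable R _ lebesgue_outer) => Y.
rewrite [X in (X + _ <= _)%E](_ : _ = 0%E).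
  by rewrite add0e; apply: le_outer_measure; exact: subIsetl.
apply/eqP; rewrite eq_le outer_measure_ge0 andbT -A0.
by apply: le_outer_measure; exact: subIsetr.
Qed.

Lemma ae_not_null A : lebesgue A = 0%E -> \forall x \ae lebesgue, ~ A x.
Proof.
move=> A0; exists A; split; [exact: lebesgue_null_measurable|exact: A0|].
by move=> x /= /contrapT.
Qed.

End lebesgue_rV.

(** * Smooth functions *)

Section expinv.
Context {R : realType}.
Implicit Types (t : R) (m : nat).

(** All exponents [m] are treated together because a derivative of a member is a linear combination
    of members, which gives smoothness by induction. *)
Definition expinv m t : R := if 0 < t then t ^- m * expR (- t^-1) else 0.

Lemma expinv_le0 m t : t <= 0 -> expinv m t = 0.
Proof. by rewrite /expinv ltNge => ->. Qed.

Lemma expinv_ge0 m t : 0 <= expinv m t.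
Proof.
rewrite /expinv; case: ifPn => // t0.
by rewrite mulr_ge0 ?expR_ge0// invr_ge0 exprn_ge0// ltW.
Qed.

(** The exponential series gives $e^{1/t}\ge t^{-(m+2)}/(m+2)!$. Order 2 is what makes the
    difference quotient at 0 tend to 0. *)
Lemma expinv_flat m t : expinv m t <= (m.+2)`!%:R * t ^+ 2.
Proof.
rewrite /expinv; case: ifPn => [t0|_]; last by rewrite mulr_ge0 ?sqr_ge0.
have w0 : 0 <= t^-1 by rewrite invr_ge0 ltW.
have tm : 0 < t ^+ m by rewrite exprn_gt0.
have E0 := expR_gt0 t^-1.
rewrite expRN -invfM -[leLHS]mul1r ler_pdivrMr ?mulr_gt0//.
have : t^-1 ^+ m.+2 / m.+2`!%:R <= expR t^-1.
  by apply: le_trans (expR_ge1Dxn m.+1 w0); rewrite lerDr.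
rewrite ler_pdivrMr; last by rewrite ltr0n fact_gt0.
rewrite exprVn -[leLHS]mul1r ler_pdivrMr ?exprn_gt0//.
rewrite -[m.+2]addn2 exprD; set F := _%:R; set E := expR _.
by move=> h; rewrite (_ : F * _ * _ = E * F * (t ^+ m * t ^+ 2))//; ring.
Qed.

Lemma is_derive_expinv m t :
  is_derive t 1 (expinv m) (expinv m.+2 t - m%:R * expinv m.+1 t).
Proof.
have [t0|t0|->] := ltgtP t 0.
- rewrite !expinv_le0 ?ltW// mulr0 subr0.
  apply: (@near_eq_is_derive R R R (cst 0)).
  by near=> s; rewrite expinv_le0//; apply: ltW; near: s; exact: lt_nbhsl.
- have tN0 : t != 0 by rewrite gt_eqF.
  pose w (y : R) := y^-1.
  have dw : is_derive t 1 w (- t ^- 2).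
    apply: DeriveDef; first exact: (@derivableV _ _ id).
    by rewrite (@deriveV _ _ id)// derive_id [_ *: 1]mulr1.
  have dE : is_derive t 1 (expR \o (- w)) (expR (- t^-1) * (t ^- 2)).
    by rewrite -[X in _ * X]opprK; apply: is_derive1_comp.
  have dwE : is_derive t 1 (w ^+ m * (expR \o (- w)))
      (expinv m.+2 t - m%:R * expinv m.+1 t).
    apply: is_derive_eq; rewrite /expinv t0 /= !fctE /w /GRing.scale/=.
    rewrite -!exprVn; case: m => [|k] /=.
      by rewrite !mul0r !subr0 !expr0; ring.
    by rewrite !exprS; ring.
  apply: near_eq_is_derive dwE.
  near=> s; have s0 : 0 < s by near: s; exact: lt_nbhsr.
  by rewrite /expinv s0 /= !fctE /w exprVn.
- rewrite !expinv_le0// mulr0 subr0.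
  have h0 : h^-1 *: ((expinv m \o shift 0) (h *: 1) - expinv m 0)
      @[h --> (0 : R)^'] --> (0 : R).
    have C0 : (m.+2)`!%:R * `|h| @[h --> (0 : R)^'] --> (0 : R).
      apply: cvg_within_filter.
      have nh : `|h| @[h --> (0 : R)] --> `|0 : R| by exact: cvg_norm.
      have : (m.+2)`!%:R * `|h| @[h --> (0 : R)] --> (m.+2)`!%:R * `|0 : R|.
        exact: cvgMl_tmp.
      by rewrite normr0 mulr0.
    apply/norm_cvg0P; apply: squeeze_cvgr C0; last exact: cvg_cst.
    apply: nearW => h; rewrite normr_ge0 /= [h *: 1]mulr1 addr0.
    rewrite (expinv_le0 _ (lexx 0)) subr0 [_ *: _]mulrC normrM normfV.
    have [->|hN0] := eqVneq h 0; first by rewrite normr0 invr0 !mulr0.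
    rewrite ler_pdivrMr ?normr_gt0// ger0_norm ?expinv_ge0//.
    by rewrite -mulrA -expr2 real_normK ?num_real//; exact: expinv_flat.
  apply: DeriveDef; first exact: cvgP h0.
  by apply/cvg_lim; [exact: Rhausdorff|exact: h0].
Unshelve. all: by end_near. Qed.

Lemma continuous_expinv m : continuous (expinv m).
Proof.
move=> t; apply/differentiable_continuous/derivable1_diffP.
by have [] := is_derive_expinv m t.
Qed.

End expinv.

Lemma is_derive_line {R : realType} {V : normedModType R} (f : V -> R) (x v : V) df :
  is_derive (0 : R) 1 (fun h => f (h *: v + x)) df -> is_derive x v f df.
Proof.
have E : (fun h : R => h^-1 *: (((fun h => f (h *: v + x)) \o shift 0) (h *: 1) -
      f (0 *: v + x))) = (fun h => h^-1 *: ((f \o shift x) (h *: v) - f x)).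
  by apply/funext => h /=; rewrite scale0r add0r addr0 [h *: 1]mulr1.
by case; rewrite /derivable /derive E; split.
Qed.

Section elementary_smooth.
Context {R : realType} {d : nat}.
Local Notation Rd := 'rV[R]_d.
Implicit Types (f g : Rd -> R).

(* This class is closed under partial derivatives, so that all its members are
   smooth. *)
Inductive elementary : (Rd -> R) -> Prop :=
| elementary_expinv m (a b : R) (i : 'I_d) :
    elementary (fun x => expinv m (a * x 0 i + b))
| elementary_cst c : elementary (fun=> c)
| elementary_add f g : elementary f -> elementary g ->
    elementary (fun x => f x + g x)
| elementary_mul f g : elementary f -> elementary g ->
    elementary (fun x => f x * g x).

Lemma elementary_continuous f : elementary f -> continuous f.
Proof.
elim=> {f} [m a b i|c|f g _ cf _ cg|f g _ cf _ cg] x.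
- have ci : (fun y : Rd => y 0 i) @ x --> (x 0 i : R) by exact: coord_continuous.
  have cm : (fun y : Rd => a * y 0 i) @ x --> a * x 0 i.
    exact: (@cvgMl_tmp R _ (nbhs x) _ _ a _ ci).
  have cl : (fun y : Rd => a * y 0 i + b) @ x --> a * x 0 i + b.
    exact: (@cvgD _ _ _ (nbhs x) _ _ _ _ _ cm (cvg_cst b)).
  apply: (@continuous_comp _ _ _ (fun x : Rd => a * x 0 i + b) (expinv m)) => //.
  exact: continuous_expinv.
- by move=> ?; apply: cst_continuous.
- exact: cvgD (cf x) (cg x).
- exact: cvgM (cf x) (cg x).
Qed.

Lemma elementary_partial (j : 'I_d) f : elementary f ->
  exists2 g, elementary g & forall x, is_derive x (delta_mx 0 j) f (g x).
Proof.
elim=> {f} [m a b i|c|f g ef [f' ef' df] eg [g' eg' dg]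
  |f g ef [f' ef' df] eg [g' eg' dg]].
- exists (fun x => (a * (i == j)%:R) *
      (expinv m.+2 (a * x 0 i + b) + - m%:R * expinv m.+1 (a * x 0 i + b))).
    have eM c k : elementary (fun x : Rd => c * expinv k (a * x 0 i + b)).
      exact: (elementary_mul (elementary_cst c) (elementary_expinv k a b i)).
    apply: (elementary_mul (elementary_cst _)).
    exact: (elementary_add (elementary_expinv _ _ _ _) (eM _ _)).
  move=> x; apply: is_derive_line.
  pose l (h : R) := a * (i == j)%:R * h + (a * x 0 i + b).
  rewrite (_ : (fun h => _) = expinv m \o l); last first.
    by apply/funext => h /=; rewrite /l !mxE/=; congr (expinv m _); ring.
  have dl : is_derive (0 : R) (1 : R) l (a * (i == j)%:R).
    have -> : l = (a * (i == j)%:R) \*: id + cst (a * x 0 i + b) by [].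
    by apply: is_derive_eq; rewrite addr0 [_ *: 1]mulr1.
  rewrite mulrC mulNr.
  have := @is_derive1_comp R (expinv m) l 0 _ _ (is_derive_expinv m (l 0)) dl.
  by rewrite {2 3}/l mulr0 add0r.
- exists (fun=> 0); first exact: elementary_cst.
  by move=> x; exact: is_derive_cst.
- exists (fun x => f' x + g' x); first exact: elementary_add.
  by move=> x; exact: is_deriveD.
- exists (fun x => f x * g' x + g x * f' x).
    by apply: elementary_add; exact: elementary_mul.
  by move=> x; exact: is_deriveM.
Qed.

Lemma elementary_smooth f : elementary f -> smooth f.
Proof.
move=> ef s.
have {ef} : elementary (foldr partial f s).
  elim: s => [//|j s IH] /=; have [g eg dg] := elementary_partial j IH.
  rewrite (_ : partial _ _ = g)//; apply/funext => x.
  by rewrite /partial; have [_ ->] := dg x.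
move=> es; split; first exact: elementary_continuous.
by move=> j x; have [g _ /(_ x)[]] := elementary_partial j es.
Qed.

Lemma elementary_prod (I : Type) (s : seq I) (F : I -> Rd -> R) :
  (forall i, elementary (F i)) -> elementary (fun x => \prod_(i <- s) F i x).
Proof.
move=> eF; elim: s => [|i s IH].
  by under eq_fun do rewrite big_nil; exact: elementary_cst.
by under eq_fun do rewrite big_cons; exact: elementary_mul.
Qed.

End elementary_smooth.

(** * Bump functions *)

Section expinv0.
Context {R : realType}.

Lemma expinv0_le1 (t : R) : expinv 0 t <= 1.
Proof.
rewrite /expinv; case: ifPn => // t0; rewrite expr0 invr1 mul1r.
by rewrite -expR0 ler_expR oppr_le0 invr_ge0 ltW.
Qed.

Lemma expinv0_cvg1 (c : R) (u : nat -> R) : 0 < c ->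
  (forall k, c * k.+1%:R <= u k) -> expinv 0 (u k) @[k --> \oo] --> (1 : R).
Proof.
move=> c0 cu.
have lo : 1 - c^-1 * k.+1%:R^-1 @[k --> \oo] --> (1 : R).
  have h : c^-1 * k.+1%:R^-1 @[k --> \oo] --> c^-1 * (0 : R).
    by apply: cvgMl_tmp; exact: cvg_harmonic.
  by have := cvgB (cvg_cst (1 : R)) h; rewrite mulr0 subr0; apply.
apply: (squeeze_cvgr _ lo (cvg_cst (1 : R))); apply: nearW => k.
rewrite expinv0_le1 andbT.
have ck : 0 < c * k.+1%:R by rewrite mulr_gt0.
have uk : 0 < u k := lt_le_trans ck (cu k).
rewrite /expinv uk expr0 invr1 mul1r; apply: le_trans (expR_ge1Dx _).
by rewrite lerD2l lerN2 -invfM lef_pV2 ?posrE// mulrC.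
Qed.

Lemma expinv0_cvg0 (u : nat -> R) : (\forall k \near \oo, u k <= 0) ->
  expinv 0 (u k) @[k --> \oo] --> (0 : R).
Proof.
move=> u0; apply: cvg_near_cst; apply: filterS u0 => k uk.
by rewrite expinv_le0.
Qed.

End expinv0.

Section bump.
Context {R : realType} {d : nat}.
Local Notation Rd := 'rV[R]_d.
Implicit Types (a b x : Rd) (O : set Rd).

(* The two slopes are chosen such that the limit is the indicator function of
   the half-open box: at [x 0 i = b 0 i] the second argument is [k.+1], whereas
   to the right of [b 0 i] it eventually becomes negative. *)
Definition box_bump k a b x : R := \prod_(i < d)
  (expinv 0 (k.+1%:R * x 0 i + - k.+1%:R * a 0 i) *
   expinv 0 (- k.+1%:R ^+ 2 * x 0 i + (k.+1%:R ^+ 2 * b 0 i + k.+1%:R))).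

Lemma elementary_bump k a b : elementary (box_bump k a b).
Proof.
apply: (@elementary_prod R d _ _ (fun (i : 'I_d) (x : Rd) =>
  expinv 0 (k.+1%:R * x 0 i + - k.+1%:R * a 0 i) *
  expinv 0 (- k.+1%:R ^+ 2 * x 0 i + (k.+1%:R ^+ 2 * b 0 i + k.+1%:R)))) => i.
exact: (elementary_mul (elementary_expinv _ _ _ _) (elementary_expinv _ _ _ _)).
Qed.

Lemma bump_ge0_le1 k a b x : 0 <= box_bump k a b x <= 1.
Proof.
rewrite /box_bump; elim/big_ind: _ => [|y z /andP[y0 y1] /andP[z0 z1]|i _].
- by rewrite ler01 lexx.
- by rewrite mulr_ge0//= mulr_ile1.
- by rewrite mulr_ge0 ?expinv_ge0//= mulr_ile1 ?expinv_ge0 ?expinv0_le1.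
Qed.

Lemma bump_cvg a b x : box_bump k a b x @[k --> \oo] --> (\1_(box (a, b)) x : R).
Proof.
have fac (i : 'I_d) : (expinv 0 (k.+1%:R * x 0 i + - k.+1%:R * a 0 i) *
   expinv 0 (- k.+1%:R ^+ 2 * x 0 i + (k.+1%:R ^+ 2 * b 0 i + k.+1%:R)))
   @[k --> \oo] --> ((a 0 i < x 0 i <= b 0 i)%R%:R : R).
  have -> : (a 0 i < x 0 i <= b 0 i)%R%:R =
      (a 0 i < x 0 i)%R%:R * (x 0 i <= b 0 i)%R%:R :> R by rewrite -natrM mulnb.
  apply: cvgM.
    have [ax|xa] := ltP (a 0 i) (x 0 i).
      apply: (@expinv0_cvg1 _ (x 0 i - a 0 i)); first by rewrite subr_gt0.
      by move=> k; rewrite le_eqVlt; apply/orP; left; apply/eqP; ring.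
    apply: expinv0_cvg0; apply: nearW => k.
    by rewrite mulNr -mulrBr mulr_ge0_le0 ?subr_le0.
  have [xb|bx] := leP (x 0 i) (b 0 i).
    apply: (@expinv0_cvg1 _ 1) => // k; rewrite mul1r addrA lerDr.
    by rewrite mulNr addrC -mulrBr mulr_ge0 ?sqr_ge0 ?subr_ge0.
  apply: expinv0_cvg0.
  have e0 : 0 < x 0 i - b 0 i by rewrite subr_gt0.
  have [N _ NP] := near_infty_natSinv_lt (PosNum e0).
  exists N => // k /NP /= ke; have K0 : 0 < k.+1%:R :> R by [].
  move: ke; rewrite invf_plt ?posrE// -[X in X < _]mul1r ltr_pdivrMr// => ke.
  rewrite (_ : _ + _ = k.+1%:R * (1 - k.+1%:R * (x 0 i - b 0 i))); last by ring.
  by rewrite pmulr_rle0// subr_le0 ltW.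
rewrite (_ : \1_(box (a, b)) x = \prod_(i < d) (a 0 i < x 0 i <= b 0 i)%R%:R).
  by apply: cvg_big => //; apply: mul_continuous.
rewrite indicE; have [xab|xab] := boolP (x \in box (a, b)).
  by rewrite big1// => i _; move: xab; rewrite inE => /(_ i) ->.
have /existsNP[i /negP/negPf xi] : ~ forall i, a 0 i < x 0 i <= b 0 i.
  by move=> h; move: xab; rewrite notin_setE; apply.
by rewrite (bigD1 i)//= xi mul0r.
Qed.

Definition closed_box a b : set Rd := [set x | forall i, a 0 i <= x 0 i <= b 0 i].

Lemma compact_closed_box a b : compact (closed_box a b).
Proof.
rewrite (_ : closed_box a b =
    [set v : Rd | forall i, `[a 0 i, b 0 i]%classic (v ord0 i)]).
  apply: (@rV_compact _ _ (fun i => `[a 0 i, b 0 i]%classic)) => i.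
  exact: segment_compact.
by apply/seteqP; split=> x h i; have := h i; rewrite /= in_itv.
Qed.

Lemma closed_closed_box a b : closed (closed_box a b).
Proof.
by apply: compact_closed; [exact: norm_hausdorff|exact: compact_closed_box].
Qed.

Lemma bump_support k a b x : box_bump k a b x != 0 ->
  forall i, a 0 i < x 0 i < b 0 i + k.+1%:R^-1.
Proof.
move=> /prodf_neq0 h i; have := h i isT; have K0 : 0 < k.+1%:R :> R by [].
rewrite mulf_eq0 negb_or => /andP[].
have pos (t : R) : expinv 0 t != 0 -> 0 < t.
  by apply: contra_neqT; rewrite -leNgt; exact: expinv_le0.
move=> /pos; rewrite mulNr -mulrBr pmulr_rgt0// subr_gt0 => -> /pos h2.
have E : - k.+1%:R ^+ 2 * x 0 i + (k.+1%:R ^+ 2 * b 0 i + k.+1%:R) =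
    k.+1%:R ^+ 2 * (b 0 i + k.+1%:R^-1 - x 0 i) by field; rewrite gt_eqF.
by move: h2; rewrite E pmulr_rgt0 ?exprn_gt0// subr_gt0.
Qed.

Lemma bump_test_function k a b O :
  closed_box a (\row_i (b 0 i + k.+1%:R^-1)) `<=` O ->
  test_function O (box_bump k a b).
Proof.
move=> abO.
have sub : closure [set x | box_bump k a b x != 0] `<=`
    closed_box a (\row_i (b 0 i + k.+1%:R^-1)).
  rewrite [X in _ `<=` X](closure_id _).1; last exact: closed_closed_box.
  apply: closureS => x /= /bump_support h i.
  by rewrite mxE; have /andP[/ltW -> /ltW ->] := h i.
split; [exact/elementary_smooth/elementary_bump| |exact: subset_trans abO].
apply: (subclosed_compact _ (@compact_closed_box _ _) sub).
exact: closed_closure.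
Qed.

End bump.

(** * Integrals over unions and increasing unions of sets *)

Section set_integral.
Context d (T : measurableType d) (R : realType).
Variable mu : {measure set T -> \bar R}.
Variable f : T -> R.
Hypothesis intf : mu.-integrable setT (EFin \o f).

Let intS A : measurable A -> mu.-integrable A (EFin \o f).
Proof. by move=> mA; exact: integrableS intf. Qed.

Lemma Rintegral_setD A B : measurable A -> measurable B -> A `<=` B ->
  \int[mu]_(x in B) f x =
  \int[mu]_(x in A) f x + \int[mu]_(x in B `\` A) f x.
Proof.
move=> mA mB AB; have mBA : measurable (B `\` A) by exact: measurableD.
rewrite -{1}(setDUK AB) Rintegral_setU//.
  by apply: intS; exact: measurableU.
by apply/disj_setPS => x [Ax []].
Qed.

Lemma Rintegral_setUI A B : measurable A -> measurable B ->
  \int[mu]_(x in A `|` B) f x =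
  \int[mu]_(x in A) f x + \int[mu]_(x in B) f x - \int[mu]_(x in A `&` B) f x.
Proof.
move=> mA mB; have mAB := measurableU _ _ mA mB; have mI := measurableI _ _ mA mB.
rewrite (Rintegral_setD mA mAB (@subsetUl _ A B)).
rewrite (Rintegral_setD mI mB (@subIsetr _ A B)).
rewrite (_ : B `\` (A `&` B) = (A `|` B) `\` A); first by ring.
apply/seteqP; split=> x /=; tauto.
Qed.

Lemma Rintegral_bigcup_eq0 (U : nat -> set T) : (forall n, measurable (U n)) ->
  nondecreasing_seq U -> (forall n, \int[mu]_(x in U n) f x = 0) ->
  \int[mu]_(x in \bigcup_n U n) f x = 0.
Proof.
move=> mU ndU U0; have mV : measurable (\bigcup_n U n) by exact: bigcupT_measurable.
have mf : measurable_fun setT (EFin \o f) by exact: measurable_int intf.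
have [] := @dominated_convergence _ T R mu setT measurableT
  (fun n => (EFin \o f) \_ (U n)) ((EFin \o f) \_ (\bigcup_n U n)) (abse \o (EFin \o f)).
- by move=> n; apply/(measurable_restrictT _ (mU n)); exact: measurable_funS mf.
- by apply/(measurable_restrictT _ mV); exact: measurable_funS mf.
- apply: aeW => x _; apply: cvg_near_cst.
  have [[m _ Um]|Vx] := pselect ((\bigcup_n U n) x).
    exists m => // n mn; rewrite /patch !mem_set//; first by exists m.
    by move/subsetPset : (ndU _ _ mn); apply.
  apply: nearW => n; rewrite /patch !memNset// => Ux; apply: Vx.
  by exists n.
- exact: integrable_abse.
- apply: aeW => x n _; rewrite /patch; case: ifP => // _.
  by rewrite abse0 abse_ge0.
have E n : (\int[mu]_x ((EFin \o f) \_ (U n)) x = 0)%E.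
  rewrite -integral_mkcond -[LHS]fineK; first by congr EFin; exact: U0.
  exact: integrable_fin_num (intS (mU n)).
move=> _ _; rewrite (_ : [sequence _]_n = fun=> 0%E); last by apply/funext.
move=> h; have := cvg_unique (@ereal_hausdorff R) h (cvg_cst 0%E).
by rewrite -integral_mkcond /Rintegral => ->.
Qed.

End set_integral.

(** * Integrals over boxes *)

Section L2_restrict.
Context d (T : measurableType d) (R : realType).
Variable mu : {measure set T -> \bar R}.

Lemma Lfun2_indic (A : set T) : measurable A -> (mu A < +oo)%E ->
  (\1_A : T -> R) \in Lfun mu 2%:E.
Proof.
move=> mA Aoo; apply/Lfun2P; split; first exact: measurable_indic.
rewrite (_ : (\int[mu]_x _)%E = mu A)//.
under eq_integral => x _.
  rewrite (_ : \1_A x ^+ 2 = \1_A x); last first.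
    by rewrite indicE; case: (_ \in _); rewrite ?expr1n ?expr0n.
  over.
by rewrite integral_indic// setIT.
Qed.

Lemma Lfun2_restrict (f : T -> R) (A : set T) : measurable A ->
  f \in Lfun mu 2%:E -> f \_ A \in Lfun mu 2%:E.
Proof.
move=> mA /Lfun2P[mf f2].
have mfA : measurable_fun setT (f \_ A).
  by apply/(measurable_restrictT _ mA); exact: measurable_funS mf.
apply/Lfun2P; split => //; apply: le_lt_trans f2.
apply: ge0_le_integral => //.
- by move=> x _; rewrite lee_fin sqr_ge0.
- by apply/measurable_EFinP; exact: measurable_funX.
- by apply/measurable_EFinP; exact: measurable_funX.
- move=> x _; rewrite lee_fin patchE; case: ifP => // _.
  by rewrite expr0n sqr_ge0.
Qed.

Lemma integrable_Lfun2_restrict (f : T -> R) (A : set T) : measurable A ->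
  (mu A < +oo)%E -> f \in Lfun mu 2%:E ->
  mu.-integrable setT (EFin \o (f \_ A)).
Proof.
move=> mA Aoo f2; rewrite patch_indic.
by apply: integrable_Lfun2M => //; exact: Lfun2_indic.
Qed.

End L2_restrict.

Section box_integrals.
Context {R : realType} {d : nat}.
Local Notation Rd := 'rV[R]_d.
Implicit Types (A B : set Rd) (ab : Rd * Rd).

Let boxy A := A = set0 \/ exists ab, A = box ab.

Lemma box_setI ab ab' : box ab `&` box ab' =
  box (\row_i Num.max (ab.1 0 i) (ab'.1 0 i), \row_i Num.min (ab.2 0 i) (ab'.2 0 i)).
Proof.
apply/seteqP; split=> [x [h h'] i|x h] /=.
  have /andP[h1 h2] := h i; have /andP[h3 h4] := h' i.
  by rewrite !mxE gt_max le_min h1 h2 h3 h4.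
split=> i; have := h i; rewrite /= !mxE gt_max le_min;
  by move=> /andP[/andP[h1 h2] /andP[h3 h4]]; apply/andP.
Qed.

Let boxyI A B : boxy A -> boxy B -> boxy (A `&` B).
Proof.
move=> [->|[ab ->]]; first by left; rewrite set0I.
move=> [->|[ab' ->]]; first by left; rewrite setI0.
by right; eexists; exact: box_setI.
Qed.

Let measurable_boxy A : boxy A -> measurable A.
Proof. by move=> [->//|[ab ->]]; exact: measurable_box. Qed.

Variable f : Rd -> R.
Hypothesis intf : lebesgue.-integrable setT (EFin \o f).
Hypothesis f_box : forall ab, \int[lebesgue]_(x in box ab) f x = 0.

Let f_boxy A : boxy A -> \int[lebesgue]_(x in A) f x = 0.
Proof. by move=> [->|[ab ->]]; [rewrite Rintegral_set0|exact: f_box]. Qed.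

(** Boxes are stable under intersection, so inclusion-exclusion handles finite unions; dominated
    convergence handles the increasing limit. *)
Let f_bigcup_boxy (S : nat -> set Rd) : (forall k, boxy (S k)) ->
  \int[lebesgue]_(x in \bigcup_k S k) f x = 0.
Proof.
move=> bS; pose U n := \big[setU/set0]_(k < n) S k.
have mU n : measurable (U n).
  by apply: bigsetU_measurable => k _; exact: measurable_boxy.
have US n : U n.+1 = U n `|` S n by rewrite /U big_ord_recr.
(* Quantified over [B] because the induction hypothesis is used for [B] and for [S n] intersected
   with [B]. *)
have UI n B : boxy B -> \int[lebesgue]_(x in U n `&` B) f x = 0.
  elim: n B => [|n IH] B bB; first by rewrite /U big_ord0 set0I Rintegral_set0.
  rewrite US setIUl Rintegral_setUI//; last 2 first.
  - by apply: measurableI => //; exact: measurable_boxy.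
  - by apply: measurable_boxy; exact: boxyI.
  rewrite setIACA setIid -setIA !IH//; last exact: boxyI.
  by rewrite f_boxy ?addr0 ?subr0//; exact: boxyI.
have U0 n : \int[lebesgue]_(x in U n) f x = 0.
  elim: n => [|n IH]; first by rewrite /U big_ord0 Rintegral_set0.
  rewrite US Rintegral_setUI//; last exact: measurable_boxy.
  by rewrite IH UI// f_boxy// addr0 subr0.
rewrite -bigcup_bigsetU_bigcup; apply: Rintegral_bigcup_eq0 => //.
- by move=> n; exact: (mU n.+1).
- apply/nondecreasing_seqP => n; apply/subsetPset.
  by have := US n.+1; rewrite /U => ->; exact: subsetUl.
- by move=> n; exact: (U0 n.+1).
Qed.

(* A set of finite measure is covered by boxes of nearly the same total volume,
   and the integral over the cover vanishes. *)
Let f_measurable A : measurable A -> (lebesgue A < +oo)%E ->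
  \int[lebesgue]_(x in A) f x = 0.
Proof.
move=> mA Aoo; apply/eqP; rewrite -normr_le0; apply/ler_addgt0Pr => e e0.
rewrite add0r; have [r [r0 rP]] := integral_normr_continuous intf e0.
have Afin : lebesgue A \is a fin_num by rewrite ge0_fin_numE.
have Alt : (lebesgue A < lebesgue A + r%:E)%E by rewrite lteDl// lte_fin.
have [_ [P [F [_ AF ->]]] Fr] := ereal_inf_lt Alt.
pose S k := if P k then box (F k) else set0.
have bS k : boxy (S k) by rewrite /S; case: ifP => _; [right; exists (F k)|left].
pose W := \bigcup_k S k.
have mW : measurable W by apply: bigcupT_measurable => k; exact: measurable_boxy.
have AW : A `<=` W by move=> x /AF[k Pk Fx]; exists k => //; rewrite /S ifT.
have mWA : measurable (W `\` A) by exact: measurableD.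
have Wr : (lebesgue (W `\` A) < r%:E)%E.
  have Wle : (lebesgue W < lebesgue A + r%:E)%E.
    apply: le_lt_trans Fr; apply: lebesgue_outer_cover_le => x [k _].
    by rewrite /S; case: ifPn => // Pk Fx; exists k.
  have WE : (lebesgue W = lebesgue A + lebesgue (W `\` A))%E.
    rewrite -{1}(setDUK AW) measureU//.
    by apply/seteqP; split=> // x [Ax []].
  by move: Wle; rewrite WE lteD2lE.
have := f_bigcup_boxy bS; rewrite (Rintegral_setD intf mA mW AW).
move=> /eqP; rewrite addr_eq0 => /eqP ->; rewrite normrN.
apply: le_trans (le_normr_Rintegral mWA _) (ltW (rP _ mWA Wr)).
exact: integrableS intf.
Qed.

(** The conclusion is confined to a box, all of whose measurable subsets have finite measure, so
    that the integral of [f] over each of them vanishes. *)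
Lemma ae_eq0_box_integrals ab : ae_eq lebesgue (box ab) f (cst 0).
Proof.
have mf : measurable_fun setT (EFin \o f) := measurable_int _ intf.
suff : ae_eq lebesgue (box ab) (EFin \o f) (cst 0%E).
  by apply: filterS => x h /h [].
apply: integral_ae_eq => //.
- exact: measurable_box.
- by apply: integrableS intf => //; exact: measurable_box.
- move=> E Eab mE; rewrite integral0.
  have Eoo : (lebesgue E < +oo)%E.
    apply: le_lt_trans (lebesgue_box_fin ab).
    exact: (le_outer_measure lebesgue_outer).
  rewrite -[LHS]fineK; first by congr EFin; exact: f_measurable.
  by apply: integrable_fin_num => //; exact: integrableS intf.
Qed.

End box_integrals.

(** * The fundamental lemma of the calculus of variations *)

Section test_functions.
Context {R : realType} {d : nat}.
Local Notation Rd := 'rV[R]_d.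
Implicit Types (O : set Rd) (f g phi : Rd -> R).

Lemma Lfun2_compact_support psi (K : set Rd) : continuous psi -> compact K ->
  (forall x, ~ K x -> psi x = 0) -> psi \in Lfun lebesgue 2%:E.
Proof.
move=> cpsi cK psi0.
have clK : closed K by apply: compact_closed => //; exact: norm_hausdorff.
have mK : measurable K.
  by rewrite -[K]setCK; apply: measurableC; apply: measurable_open; exact: closed_openC.
have Koo : (lebesgue K < +oo)%E by apply: bounded_fin; exact: compact_bounded.
have mpsi := measurable_continuous cpsi.
have /compact_bounded[M [_ /(_ (M + 1))]] : compact (psi @` K).
  by apply: continuous_compact => //; exact: continuous_subspaceT.
rewrite ltrDl ltr01 => /(_ isT) MP.
have M0 x : `|psi x| <= `|M + 1| * \1_K x.
  rewrite indicE; have [Kx|Kx] := boolP (x \in K).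
    rewrite mulr1; apply: le_trans (ler_norm _); apply: MP => /=.
    by exists x => //; rewrite inE in Kx.
  by rewrite psi0 ?normr0 ?mulr0//; rewrite notin_setE in Kx.
have /Lfun2P[mbd bd] : (fun x => `|M + 1| * \1_K x + 0) \in Lfun lebesgue 2%:E.
  by apply: Lfun2_lin; [exact: Lfun2_indic|exact: Lfun2_0].
apply/Lfun2P; split=> //; apply: le_lt_trans bd.
apply: ge0_le_integral; first exact: measurableT.
- by move=> x _; rewrite lee_fin sqr_ge0.
- by apply/measurable_EFinP; exact: measurable_funX.
- by apply/measurable_EFinP; exact: measurable_funX.
- move=> x _; rewrite lee_fin addr0 -(real_normK (num_real (psi x))).
  by rewrite ler_pXn2r ?nnegrE// mulr_ge0// indicE.
Qed.

Lemma test_functionS O O' phi : O `<=` O' -> test_function O phi ->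
  test_function O' phi.
Proof. by move=> OO' [s c sub]; split => //; exact: subset_trans OO'. Qed.

Lemma test_function_out O phi x : test_function O phi -> ~ O x -> phi x = 0.
Proof.
move=> [_ _ sub] Ox; apply: contrapT => /eqP px; apply: Ox; apply: sub.
exact: subset_closure.
Qed.

Let partial_out_closure phi j x : ~ closure [set y | phi y != 0] x ->
  partial j phi x = 0.
Proof.
move=> nx; rewrite /partial (@near_eq_derive _ _ _ _ (cst 0)).
  exact: derive_cst.
have : nbhs x (~` closure [set y | phi y != 0]).
  by apply: open_nbhs_nbhs; split => //; exact/closed_openC/closed_closure.
apply: filterS => y ny; apply: contrapT => /eqP py; apply: ny.
exact: subset_closure.
Qed.

Lemma partial_out O phi j x : test_function O phi -> ~ O x -> partial j phi x = 0.
Proof. by move=> [_ _ sub] Ox; apply: partial_out_closure => /sub. Qed.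

Lemma test_function_Lfun2 O phi : test_function O phi -> phi \in Lfun lebesgue 2%:E.
Proof.
move=> [sm cK _]; apply: Lfun2_compact_support cK _; first by have [] := sm [::].
move=> x nx; apply: contrapT => /eqP px; apply: nx; exact: subset_closure.
Qed.

Lemma partial_Lfun2 O phi j : test_function O phi ->
  partial j phi \in Lfun lebesgue 2%:E.
Proof.
move=> [sm cK _]; apply: Lfun2_compact_support cK _; first by have [] := sm [:: j].
by move=> x; exact: partial_out_closure.
Qed.

Lemma Rintegral_test O g phi :
  \int[lebesgue]_(x in O) (g x * phi x) = \int[lebesgue]_x ((g \_ O) x * phi x).
Proof.
rewrite Rintegral_mkcond; apply: eq_Rintegral => x _.
by rewrite !patchE; case: ifP => // _; rewrite mul0r.
Qed.

(** The intersection of the box with the cube is again a box; its bumps are test functions on the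
    doubled ball and converge boundedly to its indicator function. *)
Let box_integrals_eq0 (G : Rd -> R) c r : 0 < r -> G \in Lfun lebesgue 2%:E ->
  (forall phi, test_function (ball c (r *+ 2)) phi ->
    \int[lebesgue]_x (G x * phi x) = 0) ->
  forall ab, \int[lebesgue]_(x in box ab) (G \_ (cube c r)) x = 0.
Proof.
move=> r0 G2 Gphi ab; rewrite Rintegral_mkcond.
have -> : (G \_ (cube c r)) \_ (box ab) = G \_ (box ab `&` cube c r).
  by apply/funext => x; rewrite !patchE in_setI; case: (_ \in box ab).
rewrite box_setI /=; set a := \row_i _; set b := \row_i _.
rewrite (_ : G \_ _ = fun x => G x * \1_(box (a, b)) x); last exact: patch_indic.
have ca i : c 0 i - r <= a 0 i by rewrite !mxE le_max lexx orbT.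
have bc i : b 0 i <= c 0 i + r by rewrite !mxE ge_min lexx orbT.
(* Bump [k] spills over the box by at most the inverse of [k.+1]; the shift by [N] keeps this below
   [r], hence the support inside the doubled ball. *)
have [N _ NP] := near_infty_natSinv_lt (PosNum r0).
have Nr k : (k + N).+1%:R^-1 < r by apply: NP => /=; rewrite leq_addl.
pose phi k := box_bump (k + N) a b.
have phi_test k : test_function (ball c (r *+ 2)) (phi k).
  apply: bump_test_function => x xab; split=> [|j i]; first by rewrite mulr2n addr_gt0.
  rewrite (ord1 j) /ball/= ltr_norml; have := xab i; rewrite [X in _ && (_ <= X)]mxE.
  move: (Nr k) (ca i) (bc i); set s := _^-1; lra.
have phi2 k := test_function_Lfun2 (phi_test k).
have mG : measurable_fun setT G by have /Lfun2P[] := G2.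
(* All the bumps vanish off [Q], which has finite measure, so [G] restricted to [Q] is an integrable
   dominating function. *)
pose Q : set Rd := cube c (r *+ 2).
have phiQ k x : phi k x != 0 -> Q x.
  move=> /bump_support h; apply/cubeP => i; have := h i.
  move: (Nr k) (ca i) (bc i); set s := _^-1; lra.
have Q2 : (\1_Q : Rd -> R) \in Lfun lebesgue 2%:E.
  by apply: Lfun2_indic; [exact: measurable_cube|exact: lebesgue_box_fin].
have [] := @dominated_convergence _ Rd R lebesgue setT measurableT
  (fun k x => (G x * phi k x)%:E) (fun x => (G x * \1_(box (a, b)) x)%:E)
  (abse \o (EFin \o (fun x => G x * \1_Q x))).
- by move=> k; exact: measurable_int (integrable_Lfun2M G2 (phi2 k)).
- apply/measurable_EFinP; apply: measurable_funM => //.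
  by apply: measurable_indic; exact: measurable_box.
- apply: aeW => x _; apply: cvg_EFin; first exact: nearW.
  apply: cvgMl_tmp; have := @bump_cvg R d a b x.
  by rewrite -(cvg_shiftn N).
- by apply: integrable_abse; exact: integrable_Lfun2M.
- apply: aeW => x k _ /=; rewrite lee_fin !normrM ler_wpM2l//.
  have [->|px] := eqVneq (phi k x) 0; first by rewrite normr0.
  rewrite indicE mem_set/=; last exact: phiQ px.
  by have /andP[p0 p1] := bump_ge0_le1 (k + N) a b x; rewrite ger0_norm// normr1.
move=> _ _; rewrite (_ : [sequence _]_n = fun=> 0%E); last first.
  apply/funext => k; rewrite -[LHS]fineK; first by congr EFin; exact: Gphi.
  by apply: integrable_fin_num => //; exact: integrable_Lfun2M.
move=> h; have := cvg_unique (@ereal_hausdorff R) h (cvg_cst 0%E).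
by rewrite /Rintegral => ->.
Qed.

(** On a set of infinite measure a function in L^2 may fail to be integrable, so the argument is
    local: it is run on each of the countably many rational cubes, and the exceptional null sets are
    united. *)
Lemma ae_eq0_test_functions O g : open O -> L2 O g ->
  (forall phi, test_function O phi -> \int[lebesgue]_(x in O) (g x * phi x) = 0) ->
  ae_eq lebesgue O g (cst 0).
Proof.
move=> oO g2 gphi; pose G := g \_ O.
have cubes p : ball (map_mx ratr p.1 : Rd) (p.2.+1%:R^-1 *+ 2) `<=` O ->
    ae_eq lebesgue (rat_cube p) g (cst 0).
  move=> pO; have r0 : 0 < p.2.+1%:R^-1 :> R by [].
  have := @ae_eq0_box_integrals R d (G \_ (rat_cube p)).
  have Q2 : lebesgue.-integrable setT (EFin \o (G \_ (rat_cube p))).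
    by apply: integrable_Lfun2_restrict => //;
      [exact: measurable_cube|exact: lebesgue_box_fin].
  move=> /(_ Q2) h.
  have {}h := h (box_integrals_eq0 r0 g2 _).
  have {}h : forall ab, ae_eq lebesgue (box ab) (G \_ (rat_cube p)) (cst 0).
    by apply: h => phi /(test_functionS pO) /gphi; rewrite Rintegral_test.
  apply: filterS (h _) => x + xp => /(_ xp).
  rewrite /G !patchE mem_set// mem_set//.
  by rewrite (open_rat_cubes oO); exists p.
have : \forall x \ae lebesgue, forall n : nat,
    if unpickle n is Some p then
      ball (map_mx ratr p.1 : Rd) (p.2.+1%:R^-1 *+ 2) `<=` O ->
      rat_cube p x -> g x = 0
    else True.
  apply: ae_foralln => n; case: (unpickle n) => [p|]; last exact: aeW.
  have [pO|pO] := pselect (ball (map_mx ratr p.1 : Rd) (p.2.+1%:R^-1 *+ 2) `<=` O).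
    by apply: filterS (cubes _ pO) => x h _; exact: h.
  by apply: aeW.
apply: filterS => x h Ox; move: (Ox); rewrite (open_rat_cubes oO) => -[p pO px].
by have := h (pickle p); rewrite pickleK; apply.
Qed.

End test_functions.

(** * Weak partial derivatives *)

Section complete_measure.
Context d (T : measurableType d) (R : realType).
Variable mu : {measure set T -> \bar R}.
Hypothesis cmu : measure_is_complete mu.
Implicit Types (f g : T -> R).

Lemma ae_eq_measurable f g : ae_eq mu setT f g ->
  measurable_fun setT f -> measurable_fun setT g.
Proof.
move=> fg /measurable_EFinP mf; apply/measurable_EFinP.
apply: (ae_measurable_fun cmu) mf.
by apply: filterS fg => x /= h /h ->.
Qed.

Lemma Rintegral_ae_eq f g : measurable_fun setT f -> ae_eq mu setT f g ->
  \int[mu]_x f x = \int[mu]_x g x.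
Proof.
move=> mf fg; congr fine; apply: ae_eq_integral => //.
- exact/measurable_EFinP.
- by apply/measurable_EFinP; exact: ae_eq_measurable fg mf.
- by apply: filterS fg => x /= h /h ->.
Qed.

Lemma ae_eq_Lfun2 f g : ae_eq mu setT f g ->
  f \in Lfun mu 2%:E -> g \in Lfun mu 2%:E.
Proof.
move=> fg /Lfun2P[mf f2]; have mg := ae_eq_measurable fg mf.
apply/Lfun2P; split=> //.
rewrite -(@ge0_ae_eq_integral _ _ _ _ _ (fun x => (f x ^+ 2)%:E))//.
- by apply/measurable_EFinP; exact: measurable_funX.
- by apply/measurable_EFinP; exact: measurable_funX.
- by move=> x _; rewrite lee_fin sqr_ge0.
- by move=> x _; rewrite lee_fin sqr_ge0.
- by apply: filterS fg => x /= h /h ->.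
Qed.

Lemma Rintegral_Lfun2_sum (I : finType) (F G : I -> T -> R) :
  (forall i, F i \in Lfun mu 2%:E) -> (forall i, G i \in Lfun mu 2%:E) ->
  \int[mu]_x (\sum_i F i x * G i x) = \sum_i \int[mu]_x (F i x * G i x).
Proof.
move=> F2 G2; elim: (index_enum I) => [|i s IH].
  rewrite big_nil; under eq_Rintegral do rewrite big_nil.
  by rewrite /Rintegral integral0.
rewrite big_cons -IH -RintegralD//.
- by under eq_Rintegral do rewrite big_cons.
- exact: integrable_Lfun2M.
- apply/Lfun1_integrable; rewrite (_ : (fun _ => _) = (\sum_(j <- s) (F j \* G j))).
    have [l0 lD] := @Lfun_addr_closed _ T R mu 1%E (lexx _).
    elim: (s) => [|j r IHr]; first by rewrite big_nil.
    by rewrite big_cons; apply: lD => //; exact: Lfun2_mul_Lfun1.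
  by apply/funext => x; rewrite fct_sumE.
Qed.

End complete_measure.

Section weak_partial.
Context {R : realType} {d : nat}.
Local Notation Rd := 'rV[R]_d.
Implicit Types (O : set Rd) (f g phi : Rd -> R).

Lemma L2_setT f : L2 setT f = (f \in Lfun lebesgue 2%:E).
Proof. by rewrite /L2 patch_setT. Qed.

Lemma ae_eq_patch O f g : ae_eq lebesgue O f g ->
  ae_eq lebesgue setT (f \_ O) (g \_ O).
Proof.
apply: filterS => x h _; rewrite !patchE; case: ifPn => // /set_mem.
exact: h.
Qed.

Lemma ae_eq_L2 O f g : ae_eq lebesgue O f g -> L2 O f -> L2 O g.
Proof. by move=> /ae_eq_patch; exact: (ae_eq_Lfun2 lebesgue_complete). Qed.

Lemma L2_sub O O' f : measurable O -> O `<=` O' -> L2 O' f -> L2 O f.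
Proof.
move=> mO OO' f2; rewrite /L2 (_ : f \_ O = (f \_ O') \_ O).
  exact: Lfun2_restrict.
apply/funext => x; rewrite !patchE; case: ifPn => // /set_mem /OO' Ox.
by rewrite mem_set.
Qed.

Lemma is_weak_partial_ae O j f f' g : measurable O -> ae_eq lebesgue O f f' ->
  is_weak_partial O j f g -> is_weak_partial O j f' g.
Proof.
move=> mO ff' [f2 g2 h]; split; [exact: (ae_eq_L2 ff' f2)|exact: g2|].
move=> phi tphi; rewrite -(h _ tphi) !(Rintegral_test O).
have [mf _] := (Lfun2P _ _).1 f2.
have [mphi _] := (Lfun2P _ _).1 (partial_Lfun2 j tphi).
apply/esym/(Rintegral_ae_eq lebesgue_complete).
  exact: (measurable_funM mf mphi).
apply: filterS (ae_eq_patch ff') => x e _.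
by congr (_ * _); exact: e.
Qed.

Lemma is_weak_partial_sub O O' j f g : measurable O -> O `<=` O' ->
  is_weak_partial O' j f g -> is_weak_partial O j f g.
Proof.
move=> mO OO' [f2 g2 h].
split; [exact: (L2_sub mO OO' f2)|exact: (L2_sub mO OO' g2)|].
move=> phi tphi; have := h _ (test_functionS OO' tphi).
rewrite !(Rintegral_test O) !(Rintegral_test O').
have restr (u psi : Rd -> R) : (forall x, ~ O x -> psi x = 0) ->
    (fun x => (u \_ O') x * psi x) = (fun x => (u \_ O) x * psi x).
  move=> psi0; apply/funext => x; have [Ox|Ox] := pselect (O x).
    by rewrite !patchE (mem_set Ox) (mem_set (OO' _ Ox)).
  by rewrite psi0// !mulr0.
rewrite (restr f (partial j phi)); last by move=> x; exact: partial_out tphi.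
by rewrite (restr g phi)// => x; exact: test_function_out tphi.
Qed.

Lemma is_weak_partial_unique O j f g g' : open O -> is_weak_partial O j f g ->
  is_weak_partial O j f g' -> ae_eq lebesgue O g g'.
Proof.
move=> oO [_ g2 h] [_ g'2 h'].
have patchB : (fun x => g x - g' x) \_ O = (fun x => (g \_ O) x - (g' \_ O) x).
  by apply/funext => x; rewrite !patchE; case: ifP => // _; rewrite subr0.
suff : ae_eq lebesgue O (fun x => g x - g' x) (cst 0).
  by apply: filterS => x e /e /subr0_eq.
apply: ae_eq0_test_functions => //.
  by rewrite /L2 patchB; exact: Lfun2B.
move=> phi tphi; have phi2 := test_function_Lfun2 tphi.
rewrite Rintegral_test patchB; under eq_Rintegral do rewrite mulrBl.
rewrite RintegralB//; [|exact: (integrable_Lfun2M g2 phi2)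
  |exact: (integrable_Lfun2M g'2 phi2)].
by rewrite -!(Rintegral_test O) -[X in X - _]opprK -h// h'// opprK subrr.
Qed.

Lemma weak_partialP O j f g : is_weak_partial O j f g ->
  is_weak_partial O j f (weak_partial O j f).
Proof. by move=> h; apply: getPex; exists g. Qed.

Lemma weak_partial_ae O j f g : open O -> is_weak_partial O j f g ->
  ae_eq lebesgue O (weak_partial O j f) g.
Proof.
by move=> oO h; apply: is_weak_partial_unique oO (weak_partialP h) h.
Qed.

Lemma is_weak_partial0 O j : is_weak_partial O j (fun=> 0) (fun=> 0).
Proof.
have z2 : L2 O (fun=> 0 : R).
  rewrite /L2 (_ : _ \_ _ = fun=> 0); first exact: Lfun2_0.
  by apply/funext => x; rewrite patchE; case: ifP.
split=> // phi _.
rewrite (_ : (fun x => 0 * partial j phi x) = fun=> 0); last first.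
  by apply/funext => x; rewrite mul0r.
rewrite (_ : (fun x => 0 * phi x) = fun=> 0); last first.
  by apply/funext => x; rewrite mul0r.
by rewrite /Rintegral integral0 oppr0.
Qed.

(** Weak derivatives are local. This gives the vanishing off the closure of the gradient of a field
    in W, where it is only demanded of the field itself. *)
Lemma is_weak_partial_eq0 O j f g : open O -> is_weak_partial setT j f g ->
  ae_eq lebesgue O f (cst 0) -> ae_eq lebesgue O g (cst 0).
Proof.
move=> oO fg f0; have mO := measurable_open oO.
have h1 := is_weak_partial_sub mO (@subsetT _ O) fg.
apply: (is_weak_partial_unique oO h1).
by apply: (is_weak_partial_ae mO) (is_weak_partial0 O j); exact: ae_eq_sym.
Qed.

End weak_partial.

(** * Families of functions in L^2 *)

Section L2_family.
Context d (T : measurableType d) (R : realType) (I : finType).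
Variable mu : {measure set T -> \bar R}.
Local Notation X := (I -> T -> R^o).
Implicit Types (F G : X).

Definition L2_family : set X := [set F | forall k, F k \in Lfun mu 2%:E].

Definition family_inner F G : R := \sum_k \int[mu]_x (F k x * G k x).

Lemma L2_family0 : L2_family 0.
Proof. by move=> k; exact: Lfun2_0. Qed.

Lemma L2_family_lin a F G : L2_family F -> L2_family G -> L2_family (a *: F + G).
Proof. by move=> F2 G2 k; exact: Lfun2_lin. Qed.

Lemma family_inner_sym F G : family_inner F G = family_inner G F.
Proof.
apply: eq_bigr => k _; apply: eq_Rintegral => x _; exact: mulrC.
Qed.

Lemma family_inner_lin a F G H : L2_family F -> L2_family G -> L2_family H ->
  family_inner (a *: F + G) H = a * family_inner F H + family_inner G H.
Proof.
move=> F2 G2 H2; rewrite /family_inner mulr_sumr -big_split/=.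
apply: eq_bigr => k _.
have iF := integrable_Lfun2M (F2 k) (H2 k).
have iG := integrable_Lfun2M (G2 k) (H2 k).
have aF2 : (fun x => a * F k x) \in Lfun mu 2%:E.
  by have := Lfun2_lin a (F2 k) (Lfun2_0 mu); under eq_fun do rewrite addr0.
have iaF := integrable_Lfun2M aF2 (H2 k).
rewrite -(@RintegralZl _ T R mu setT _ a measurableT iF).
transitivity (\int[mu]_x (a * F k x * H k x + G k x * H k x)).
  by apply: eq_Rintegral => x _; rewrite -mulrDl.
rewrite (@RintegralD _ T R mu setT _ _ measurableT iaF iG); congr (_ + _).
by apply: eq_Rintegral => x _; rewrite mulrA.
Qed.

Lemma family_inner_ge0 F : 0 <= family_inner F F.
Proof.
apply: sumr_ge0 => k _; apply: Rintegral_ge0 => x _.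
by rewrite -expr2 sqr_ge0.
Qed.

Lemma component_le_family_inner F k :
  \int[mu]_x (F k x * F k x) <= family_inner F F.
Proof.
rewrite /family_inner (bigD1 k)//= lerDl; apply: sumr_ge0 => i _.
by apply: Rintegral_ge0 => x _; rewrite -expr2 sqr_ge0.
Qed.

Lemma family_inner_eq0 F k : L2_family F -> family_inner F F = 0 ->
  ae_eq mu setT (F k) (cst 0).
Proof.
move=> F2 F0; apply: Rintegral_sqr_eq0; first exact: F2.
apply/eqP; rewrite eq_le -{1}F0 component_le_family_inner/=.
by apply: Rintegral_ge0 => x _; rewrite -expr2 sqr_ge0.
Qed.

Lemma L2_family_complete (u : nat -> X) : (forall n, L2_family (u n)) ->
  cauchy_for family_inner u ->
  exists2 F, L2_family F & family_inner (u n - F) (u n - F) @[n --> \oo] --> 0.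
Proof.
move=> u2 uC.
have /choice[F FP] : forall k, exists f : T -> R, f \in Lfun mu 2%:E /\
    \int[mu]_x ((u n k x - f x) * (u n k x - f x)) @[n --> \oo] --> 0.
  move=> k; have [|e e0|f f2 uf] := @Lfun2_complete _ T R mu (fun n => u n k).
  - by move=> n; exact: u2.
  - have [N NP] := uC _ e0; exists N => m n Nm Nn.
    exact: le_lt_trans (component_le_family_inner (u m - u n) k) (NP _ _ Nm Nn).
  - by exists f.
exists F; first by move=> k; have [] := FP k.
have h : \sum_(k : I) \int[mu]_x ((u n k x - F k x) * (u n k x - F k x))
    @[n --> \oo] --> \sum_(k : I) (0 : R).
  apply: cvg_big => [|k _]; first exact: add_continuous.
  by have [] := FP k.
by rewrite big1 in h.
Qed.

End L2_family.

(** * Divergence-free fields as an orthogonal complement *)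

Section divergence_free.
Context {R : realType} {d : nat}.
Local Notation Rd := 'rV[R]_d.
Local Notation Idx := ('I_d + 'I_d * 'I_d)%type.
Local Notation X := (Idx -> Rd -> R^o).
Local Notation L := (@L2_family _ Rd R Idx lebesgue).
Local Notation B := (@family_inner _ Rd R Idx lebesgue).
Local Notation off O := (~` closure O).
Implicit Types (O : set Rd) (F G : X) (f g h phi : Rd -> R).

(* [F (inl i)] is the i-th component of a vector field in the space W(O),
   extended by zero, and [F (inr (i, j))] its weak partial derivative along the
   j-th axis, so that the inner product of families is that of H^1. *)
Definition divfree O F : Prop :=
  [/\ L F,
      forall i j, is_weak_partial setT j (F (inl i)) (F (inr (i, j))),
      forall k, ae_eq lebesgue (off O) (F k) (cst 0) &
      ae_eq lebesgue setT (fun x => \sum_i F (inr (i, i)) x) (cst 0)].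

(** Orthogonality to such a family is the integration by parts formula for the [i]-th component, the
    [j]-th derivative and [phi]. *)
Definition grad_test : set X := [set psi | exists i j phi,
  test_function setT phi /\ psi = fun k => match k with
    | inl i' => if i' == i then partial j phi else cst 0
    | inr p => if p == (i, j) then phi else cst 0
    end].

Definition support_test O : set X := [set psi | exists k h,
  [/\ h \in Lfun lebesgue 2%:E, forall x, closure O x -> h x = 0 &
      psi = fun k' => if k' == k then h else cst 0]].

Definition div_test : set X := [set psi | exists2 h,
  h \in Lfun lebesgue 2%:E & psi = fun k => match k with
    | inl _ => cst 0
    | inr p => if p.1 == p.2 then h else cst 0
    end].

Definition divfree_tests O := grad_test `|` support_test O `|` div_test.

Lemma divfree_tests_L2 O : divfree_tests O `<=` L.
Proof.
have z2 : cst 0 \in Lfun (@lebesgue R d) 2%:E by exact: Lfun2_0.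
move=> _ [[[i [j [phi [tphi ->]]]]|[k [h [h2 _ ->]]]]|[h h2 ->]].
- case=> [i'|p]; case: ifP => // _; first exact: partial_Lfun2 tphi.
  exact: test_function_Lfun2 tphi.
- by move=> k'; case: ifP.
- by case=> [//|p]; case: ifP.
Qed.

Let Rint0 f : \int[lebesgue]_x (f x * cst 0 x) = 0 :> R.
Proof.
under eq_Rintegral do rewrite /= mulr0.
by rewrite /Rintegral integral0.
Qed.

Let sum_single (J : finType) (F : J -> Rd -> R) (j : J) h :
  \sum_j' \int[lebesgue]_x (F j' x * (if j' == j then h else cst 0) x) =
  \int[lebesgue]_x (F j x * h x).
Proof.
rewrite (bigD1 j)//= eqxx big1 ?addr0// => j' /negPf ->.
exact: Rint0.
Qed.

Let sum_zero (J : finType) (F : J -> Rd -> R) :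
  \sum_j' \int[lebesgue]_x (F j' x * cst 0 x) = 0.
Proof. by rewrite big1// => j' _; exact: Rint0. Qed.

Let inner_grad_test F i j phi :
  B F (fun k => match k with
    | inl i' => if i' == i then partial j phi else cst 0
    | inr p => if p == (i, j) then phi else cst 0
    end) = \int[lebesgue]_x (F (inl i) x * partial j phi x) +
           \int[lebesgue]_x (F (inr (i, j)) x * phi x).
Proof.
rewrite /family_inner big_sumType/=.
by rewrite (sum_single (fun i => F (inl i))) (sum_single (fun p => F (inr p))).
Qed.

Let inner_div_test F h : L F -> h \in Lfun lebesgue 2%:E ->
  B F (fun k => match k with
    | inl _ => cst 0
    | inr p => if p.1 == p.2 then h else cst 0
    end) = \int[lebesgue]_x ((\sum_i F (inr (i, i)) x) * h x).
Proof.
move=> F2 h2; rewrite /family_inner big_sumType/= (sum_zero (fun i => F (inl i))) add0r.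
transitivity (\sum_i \sum_j \int[lebesgue]_x
    (F (inr (i, j)) x * (if i == j then h else cst 0) x)).
  by rewrite pair_bigA; apply: eq_bigr => -[].
transitivity (\sum_i \int[lebesgue]_x (F (inr (i, i)) x * h x)).
  apply: eq_bigr => i _; rewrite -(sum_single (fun j => F (inr (i, j)))).
  by apply: eq_bigr => j _; rewrite eq_sym.
rewrite -(Rintegral_Lfun2_sum (fun i => F2 (inr (i, i))) (fun=> h2)).
by apply: eq_Rintegral => x _; rewrite mulr_suml.
Qed.

Let Rint_ae0 f h : f \in Lfun lebesgue 2%:E -> h \in Lfun lebesgue 2%:E ->
  ae_eq lebesgue setT (fun x => f x * h x) (cst 0) ->
  \int[lebesgue]_x (f x * h x) = 0.
Proof.
move=> /Lfun2P[mf _] /Lfun2P[mh _] /(Rintegral_ae_eq lebesgue_complete) ->.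
  by rewrite /Rintegral integral0.
exact: measurable_funM.
Qed.

(** The tests on the support and on the divergence range over arbitrary functions of L^2, so that a
    component cut off outside the closure, or the divergence itself, can serve as its own test and
    is seen to have norm 0. *)
Lemma divfreeP O F : divfree O F <-> ortho_compl L B (divfree_tests O) F.
Proof.
split=> [[F2 Fwp Foff Fdiv]|[F2 FP]].
  split=> // _ [[[i [j [phi [tphi ->]]]]|[k [h [h2 h0 ->]]]]|[h h2 ->]].
  - rewrite inner_grad_test; have [_ _ /(_ _ tphi) ->] := Fwp i j.
    by rewrite addNr.
  - rewrite /family_inner sum_single.
    apply: Rint_ae0 => //; apply: filterS (Foff k) => x Fx _ /=.
    have [cx|cx] := pselect (closure O x); first by rewrite h0// mulr0.
    by rewrite Fx// mul0r.
  - rewrite inner_div_test//.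
    apply: Rint_ae0 => //; first by apply: Lfun2_sum => i; exact: F2.
    by apply: filterS Fdiv => x e _; rewrite e//= mul0r.
split=> //.
- move=> i j; split.
  + by rewrite L2_setT; exact: F2.
  + by rewrite L2_setT; exact: F2.
  + move=> phi tphi; apply/eqP; rewrite -addr_eq0 -inner_grad_test; apply/eqP.
    by apply: FP; left; left; exists i, j, phi.
- move=> k; pose h := F k \_ (off O).
  have mO : measurable (off O).
    by apply: measurable_open; exact/closed_openC/closed_closure.
  have h2 : h \in Lfun lebesgue 2%:E by exact: Lfun2_restrict.
  have : ae_eq lebesgue setT h (cst 0).
    apply: Rintegral_sqr_eq0 => //.
    transitivity (\int[lebesgue]_x (F k x * h x)).
      apply: eq_Rintegral => x _; rewrite /h !patchE.
      by case: ifP => _; rewrite ?mulr0.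
    rewrite -(sum_single F); apply: FP; left; right; exists k, h; split=> //.
    by move=> x cx; rewrite /h patchE memNset//; exact.
  by apply: filterS => x + nx => /(_ I); rewrite /h patchE mem_set.
- pose h x := \sum_i F (inr (i, i)) x.
  have h2 : h \in Lfun lebesgue 2%:E by apply: Lfun2_sum => i; exact: F2.
  apply: Rintegral_sqr_eq0 => //; rewrite -(inner_div_test F2 h2).
  by apply: FP; right; exists h.
Qed.

End divergence_free.

(** * Representatives of the elements of W *)

Section stokes_space.
Context {R : realType} {d : nat}.
Local Notation Rd := 'rV[R]_d.
Local Notation Idx := ('I_d + 'I_d * 'I_d)%type.
Local Notation X := (Idx -> Rd -> R^o).
Local Notation L := (@L2_family _ Rd R Idx lebesgue).
Local Notation B := (@family_inner _ Rd R Idx lebesgue).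
Implicit Types (O : set Rd) (F G : X) (u v w f : Rd -> Rd).

(** The gradient entries are left free: [divfree] determines them almost everywhere. *)
Definition represents O u F : Prop :=
  forall i, ae_eq lebesgue O (component u i) (F (inl i)).

Lemma ae_eq_componentP O u v :
  ae_eq lebesgue O u v <->
  forall i, ae_eq lebesgue O (component u i) (component v i).
Proof.
split=> [uv i|uv]; first by apply: filterS uv => x e /e; rewrite /component => ->.
have : \forall x \ae lebesgue, forall i, O x -> component u i x = component v i x.
  by apply: filter_forall => i; exact: uv.
apply: filterS => x e Ox; apply/rowP => i; exact: e.
Qed.

Lemma Wspace_divfree O u : Wspace O u -> exists2 F, divfree O F & represents O u F.
Proof.
move=> [U [[U2 Uwp] Uoff Udiv uU]].
pose F : X := fun k => match k with
  | inl i => component U i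
  | inr p => weak_partial setT p.2 (component U p.1)
  end.
have Fwp i j : is_weak_partial setT j (F (inl i)) (F (inr (i, j))).
  by have [g] := Uwp i j; exact: weak_partialP.
have Foff i : ae_eq lebesgue (~` closure O) (component U i) (cst 0).
  by apply: filterS Uoff => x e /e; rewrite /component => ->; rewrite mxE.
have oO : open (~` closure O) by exact/closed_openC/closed_closure.
exists F; last by move=> i; apply: (ae_eq_componentP O u U).1.
split=> //.
- case=> [i|[i j]]; first by rewrite -L2_setT; exact: U2.
  by have [_] := Fwp i j; rewrite L2_setT.
- case=> [//|[i j]]; exact: is_weak_partial_eq0 (Fwp i j) (Foff i).
Qed.

Lemma divfree_Wspace O u F : divfree O F -> represents O u F -> Wspace O u.
Proof.
move=> [F2 Fwp Foff Fdiv] uF; pose U x := \row_i F (inl i) x.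
have UE i : component U i = F (inl i) by apply/funext => x; rewrite /component mxE.
exists U; split.
- split=> [i|i j]; rewrite UE; first by rewrite L2_setT.
  by exists (F (inr (i, j))).
- apply/ae_eq_componentP => i; rewrite UE; apply: filterS (Foff (inl i)) => x e /e ->.
  by rewrite /component mxE.
- have : \forall x \ae lebesgue, forall i,
      setT x -> weak_partial setT i (component U i) x = F (inr (i, i)) x.
    apply: filter_forall => i; rewrite UE.
    by apply: weak_partial_ae => //; exact: openT.
  apply: filterS2 Fdiv => x + e xT => /(_ xT) <-.
  by rewrite /div; apply: eq_bigr => i _; exact: e.
- by apply/ae_eq_componentP => i; rewrite UE; exact: uF.
Qed.

Lemma divfree_sub O O' F : closure O `<=` closure O' -> divfree O F -> divfree O' F.
Proof.
move=> OO' [F2 Fwp Foff Fdiv]; split=> // k.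
by apply: ae_eq_subset (Foff k); exact: subsetC.
Qed.

(** Elements of W vanish off the closure; a null boundary improves this to vanishing off [O], so
    that integrals over [O] and over R^d coincide. *)
Lemma ae_eq_off_boundary O (f g : Rd -> R) : open O ->
  hausdorff (boundary O) = 0%E -> ae_eq lebesgue (~` closure O) f g ->
  ae_eq lebesgue (~` O) f g.
Proof.
move=> oO /hausdorff_null_lebesgue O0 fg.
have nO := ae_not_null O0.
apply: filterS2 fg nO => x e bx Ox; apply: e => cx; apply: bx.
by split=> //; rewrite (interior_id _).1.
Qed.

Lemma dotr_representatives O (a b : Rd -> Rd) (A A' : 'I_d -> Rd -> R) :
  (forall i, ae_eq lebesgue O (component a i) (A i)) ->
  (forall i, ae_eq lebesgue O (component b i) (A' i)) ->
  (forall i, ae_eq lebesgue (~` O) (A i) (cst 0)) ->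
  ae_eq lebesgue setT (fun x => \sum_i A i x * A' i x)
    ((fun x => dotr (a x) (b x)) \_ O).
Proof.
move=> aA bA A0.
have aA' : \forall x \ae lebesgue, forall i, O x -> component a i x = A i x.
  by apply: filter_forall => i; exact: aA.
have bA' : \forall x \ae lebesgue, forall i, O x -> component b i x = A' i x.
  by apply: filter_forall => i; exact: bA.
have A0' : \forall x \ae lebesgue, forall i, (~` O) x -> A i x = cst 0 x.
  by apply: filter_forall => i; exact: A0.
apply: filterS3 aA' bA' A0' => x ha hb h0 _; rewrite patchE.
case: ifPn => [/set_mem Ox|]; first by apply: eq_bigr => i _; rewrite -ha// -hb.
by rewrite notin_setE => nOx; rewrite big1// => i _; rewrite h0//= mul0r.
Qed.

Let measurable_sum_mul (A A' : 'I_d -> Rd -> R) :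
  (forall i, A i \in Lfun lebesgue 2%:E) -> (forall i, A' i \in Lfun lebesgue 2%:E) ->
  measurable_fun setT (fun x => \sum_i A i x * A' i x).
Proof.
move=> A2 A'2; apply: measurable_sum => i; apply: measurable_funM.
  by have /Lfun2P[] := A2 i.
by have /Lfun2P[] := A'2 i.
Qed.

Lemma inner_representatives O (a b : Rd -> Rd) (A A' : 'I_d -> Rd -> R) :
  (forall i, A i \in Lfun lebesgue 2%:E) -> (forall i, A' i \in Lfun lebesgue 2%:E) ->
  (forall i, ae_eq lebesgue O (component a i) (A i)) ->
  (forall i, ae_eq lebesgue O (component b i) (A' i)) ->
  (forall i, ae_eq lebesgue (~` O) (A i) (cst 0)) ->
  inner O a b = \sum_i \int[lebesgue]_x (A i x * A' i x).
Proof.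
move=> A2 A'2 aA bA A0.
rewrite -(Rintegral_Lfun2_sum A2 A'2) /inner Rintegral_mkcond.
apply/esym/(Rintegral_ae_eq lebesgue_complete); first exact: measurable_sum_mul.
exact: dotr_representatives.
Qed.

Lemma L2norm_representatives O (a : Rd -> Rd) (A : 'I_d -> Rd -> R) :
  (forall i, A i \in Lfun lebesgue 2%:E) ->
  (forall i, ae_eq lebesgue O (component a i) (A i)) ->
  (forall i, ae_eq lebesgue (~` O) (A i) (cst 0)) ->
  L2norm O a = (Num.sqrt (\sum_i \int[lebesgue]_x (A i x * A i x)))%:E.
Proof.
move=> A2 aA A0.
pose g x := \sum_i A i x * A i x.
have ag := dotr_representatives aA aA A0.
have mg : measurable_fun setT g := measurable_sum_mul A2 A2.
have g0 x : 0 <= g x by apply: sumr_ge0 => i _; rewrite -expr2 sqr_ge0.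
have gE : (\int[lebesgue]_x (g x)%:E)%E =
    (\sum_i \int[lebesgue]_x (A i x * A i x))%:E.
  transitivity (\sum_i \int[lebesgue]_x (A i x ^+ 2)%:E)%E.
    rewrite -ge0_integral_sum; last first.
    - by move=> i x _; rewrite lee_fin sqr_ge0.
    - move=> i; apply/measurable_EFinP; apply: measurable_funX.
      by have /Lfun2P[] := A2 i.
    - exact: measurableT.
    by apply: eq_integral => x _; rewrite /g -sumEFin.
  by rewrite -sumEFin; apply: eq_bigr => i _; exact: Lfun2_fin.
rewrite -powR12_sqrt; last first.
  by rewrite -lee_fin -gE; apply: integral_ge0 => x _; rewrite lee_fin.
rewrite -poweR_EFin -gE /L2norm unlock /Lnorm; congr (_ `^ _)%E.
apply/esym; pose h := (fun x => dotr (a x) (a x)) \_ O.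
transitivity (\int[lebesgue]_x (h x)%:E)%E.
  apply: ae_eq_integral; first exact: measurableT.
  - exact/measurable_EFinP.
  - by apply/measurable_EFinP; exact: (ae_eq_measurable lebesgue_complete ag mg).
  - by apply: filterS ag => x e _; congr EFin; exact: e.
apply: eq_integral => x _; rewrite /h /= !patchE; case: ifP => _.
  rewrite powR_mulrn// real_normK ?num_real// sqr_sqrtr//.
  by apply: sumr_ge0 => i _; rewrite -expr2 sqr_ge0.
by rewrite normr0 powR0.
Qed.

Section operator.
Variable O : set Rd.
Hypothesis oO : open O.
Hypothesis bO : hausdorff (boundary O) = 0%E.

Let mO : measurable O. Proof. exact: measurable_open. Qed.

Let off_O F k : divfree O F -> ae_eq lebesgue (~` O) (F k) (cst 0).
Proof. by move=> [_ _ /(_ k) + _]; exact: ae_eq_off_boundary. Qed.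

(** The form uses weak derivatives on [O], the families those on R^d. The restriction of the latter
    is a weak derivative on [O], and uniqueness on the open set [O] makes the two agree almost
    everywhere. *)
Lemma form_a_representatives u v F G : divfree O F -> represents O u F ->
  divfree O G -> represents O v G ->
  form_a O u v = \sum_p \int[lebesgue]_x (F (inr p) x * G (inr p) x).
Proof.
move=> DF uF DG vG.
have wpE w H : divfree O H -> represents O w H -> forall i j,
    ae_eq lebesgue O (weak_partial O j (component w i)) (H (inr (i, j))).
  move=> [_ Hwp _ _] wH i j; apply: weak_partial_ae => //.
  apply: (is_weak_partial_ae mO (ae_eq_sym (wH i))).
  exact: is_weak_partial_sub (Hwp i j).
have [F2 _ _ _] := DF; have [G2 _ _ _] := DG.
rewrite /form_a; transitivity (\sum_j \sum_i \int[lebesgue]_x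
    (F (inr (i, j)) x * G (inr (i, j)) x)).
  apply: eq_bigr => j _; apply: inner_representatives => //.
  - move=> i; rewrite (_ : component _ _ = weak_partial O j (component u i)).
      exact: wpE.
    by apply/funext => x; rewrite /component mxE.
  - move=> i; rewrite (_ : component _ _ = weak_partial O j (component v i)).
      exact: wpE.
    by apply/funext => x; rewrite /component mxE.
  - by move=> i; exact: off_O.
by rewrite exchange_big pair_bigA; apply: eq_bigr => -[].
Qed.

Definition extension_family f : X := fun k => match k with
  | inl i => component f i \_ O
  | inr _ => cst 0
  end.

Lemma extension_family_L2 f : L2vec O f -> L (extension_family f).
Proof. by move=> f2 [i|p]; [exact: f2|exact: Lfun2_0]. Qed.

(** With $w=f-u$ the left side is $\langle f,v\rangle-\langle u,v\rangle_{H^1}$. Its vanishing for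
    all [v] is thus both the equation for the operator and the orthogonality that defines a
    projection. *)
Lemma stokes_residual u v w f F G : L2vec O f ->
  (forall i, ae_eq lebesgue O (component w i) (component (f \- u) i)) ->
  divfree O F -> represents O u F -> divfree O G -> represents O v G ->
  inner O w v - form_a O u v = B (extension_family f - F) G.
Proof.
move=> f2 wfu DF uF DG vG; have [F2 _ _ _] := DF; have [G2 _ _ _] := DG.
rewrite (form_a_representatives DF uF DG vG).
rewrite (@inner_representatives O w v
  (fun i x => (component f i \_ O) x - F (inl i) x) (fun i => G (inl i)))//.
- rewrite /family_inner big_sumType/=; congr (_ + _).
  rewrite -sumrN; apply: eq_bigr => p _; rewrite -[LHS]mulN1r.
  rewrite -RintegralZl//; last exact: integrable_Lfun2M.
  by apply: eq_Rintegral => x _; rewrite mulN1r -mulNr -[- F _ _]add0r.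
- by move=> i; apply: Lfun2B; [exact: f2|exact: F2].
- move=> i; apply: filterS2 (wfu i) (uF i) => x e1 e2 Ox.
  rewrite e1// -e2// patchE mem_set// /component mxE.
  by rewrite mxE.
- move=> i; apply: filterS (off_O (inl i) DF) => x e nOx.
  by rewrite e// patchE memNset// subr0.
Qed.

End operator.

End stokes_space.

(** * The resolvents *)

Section resolvent.
Context {R : realType} {d : nat}.
Local Notation Rd := 'rV[R]_d.
Local Notation Idx := ('I_d + 'I_d * 'I_d)%type.
Local Notation X := (Idx -> Rd -> R^o).
Local Notation L := (@L2_family _ Rd R Idx lebesgue).
Local Notation B := (@family_inner _ Rd R Idx lebesgue).
Local Notation V O := (ortho_compl L B (divfree_tests O)).
Implicit Types (O : set Rd) (F G : X) (u v w f : Rd -> Rd).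

Let L0 : L 0 := L2_family0 lebesgue.
Let Llin a F G : L F -> L G -> L (a *: F + G) := @L2_family_lin _ _ _ _ lebesgue a F G.
Let Bsym F G : B F G = B G F := family_inner_sym lebesgue F G.
Let Blin a F G H : L F -> L G -> L H ->
  B (a *: F + G) H = a * B F H + B G H := @family_inner_lin _ _ _ _ lebesgue a F G H.
Let Bge0 F : 0 <= B F F := family_inner_ge0 lebesgue F.
Let Bcomplete := @L2_family_complete _ Rd R Idx lebesgue.

Lemma divfree_exists_projection O F : L F -> exists p, projects_on B (V O) F p.
Proof.
move=> LF; apply: (projection_exists L0 Llin Bsym Blin Bge0 Bcomplete _ LF).
exact: divfree_tests_L2.
Qed.

Lemma divfreeB O F G : divfree O F -> divfree O G -> divfree O (G - F).
Proof.
move=> /divfreeP VF /divfreeP VG; apply/divfreeP.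
rewrite addrC -scaleN1r.
by apply: (ortho_compl_lin Llin Blin _ _ VF VG); exact: divfree_tests_L2.
Qed.

Lemma represents_row F O : represents O (fun x => \row_i F (inl i) x) F.
Proof. by move=> i; apply: aeW => x _; rewrite /component mxE. Qed.

Lemma WspaceB O u v : Wspace O u -> Wspace O v -> Wspace O (v \- u).
Proof.
move=> /Wspace_divfree[F DF uF] /Wspace_divfree[G DG vG].
apply: (divfree_Wspace (divfreeB DF DG)) => i.
apply: filterS2 (uF i) (vG i) => x e1 e2 Ox.
by rewrite /component !mxE; congr (_ - _); [exact: e2|exact: e1].
Qed.

Lemma Wspace_L2vec O u : open O -> Wspace O u -> L2vec O u.
Proof.
move=> oO /Wspace_divfree[F [F2 _ _ _] uF] i.
apply: (ae_eq_L2 (ae_eq_sym (uF i))).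
by apply: (L2_sub (measurable_open oO) (@subsetT _ O)); rewrite L2_setT; exact: F2.
Qed.

(** Needed for $w=f-u$ to be an admissible value of the operator; approximants of [f] minus [u]
    approximate the difference. *)
Lemma EspaceB O f u : open O -> Espace O f -> Wspace O u -> Espace O (f \- u).
Proof.
move=> oO [f2 fW] Wu; split=> [i|e /fW[w Ww we]].
  rewrite /L2 (_ : _ \_ O =
      (fun x => (component f i \_ O) x - (component u i \_ O) x)).
    by apply: Lfun2B; [exact: f2|exact: (Wspace_L2vec oO Wu)].
  apply/funext => x; rewrite !patchE /component; case: ifP => _; last by rewrite subr0.
  by rewrite !mxE.
exists (w \- u); first exact: WspaceB.
rewrite (_ : (f \- u) \- (w \- u) = f \- w)//.
by apply/funext => x /=; rewrite opprB addrA subrK.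
Qed.

Lemma id_plus_stokesP O u f : open O -> hausdorff (boundary O) = 0%E ->
  Espace O f -> id_plus_stokes O u f <-> exists F,
    [/\ divfree O F, represents O u F &
        projects_on B (V O) (extension_family O f) F].
Proof.
move=> oO bO Ef; have [f2 _] := Ef; split.
  move=> [w [Wu Ew h] uwf]; have [F DF uF] := Wspace_divfree Wu.
  exists F; split=> //; split=> [|G /divfreeP DG]; first exact/divfreeP.
  have vG := represents_row G O.
  rewrite -(stokes_residual oO bO f2 _ DF uF DG vG (w := w)).
    by rewrite h ?subrr//; exact: divfree_Wspace DG vG.
  move=> i; apply: filterS uwf => x e Ox; rewrite /component /= -(e Ox) /=.
  by rewrite addrC addrA addNr add0r.
move=> [F [DF uF [_ Fproj]]]; have Wu := divfree_Wspace DF uF.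
exists (f \- u); last by apply: aeW => x _ /=; rewrite addrC subrK.
split=> //; first exact: EspaceB.
move=> v Wv; have [G DG vG] := Wspace_divfree Wv.
apply/esym/eqP; rewrite -subr_eq0; apply/eqP.
rewrite (stokes_residual oO bO f2 _ DF uF DG vG); last first.
  by move=> i; apply: aeW.
by apply: Fproj; exact/divfreeP.
Qed.

Lemma resolventP O f : open O -> hausdorff (boundary O) = 0%E ->
  Espace O f -> is_resolvent O f (resolvent O f).
Proof.
move=> oO bO Ef; have [f2 _] := Ef; have Lf := extension_family_L2 f2.
have [P VP] := divfree_exists_projection O Lf.
have ex : exists u, id_plus_stokes O u f.
  exists (fun x => \row_i P (inl i) x); apply/(id_plus_stokesP _ oO bO Ef).
  exists P; split=> //; last exact: represents_row.
  by apply/divfreeP; have [] := VP.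
have res : id_plus_stokes O (resolvent O f) f.
  exact: (@getPex _ [set u | id_plus_stokes O u f]).
split=> // v /(id_plus_stokesP _ oO bO Ef)[G [DG vG pG]].
move: res => /(id_plus_stokesP _ oO bO Ef)[F [DF uF pF]].
have q0 := projection_unique L0 Llin Bsym Blin Bge0 (@divfree_tests_L2 R d O) Lf pG pF.
apply/ae_eq_componentP => i.
have [L2G _ _ _] := DG; have [L2F _ _ _] := DF.
have LGF : L (G - F) by have [] := divfreeB DF DG.
have GF0 := family_inner_eq0 (inl i) LGF q0.
apply: filterS3 GF0 (vG i) (uF i) => x e0 e1 e2 Ox.
rewrite e1// e2//; apply: subr0_eq; exact: e0.
Qed.

(** * Extension by zero and shrinking domains *)

Lemma extend0_patch O O' f i : O `<=` O' ->
  component (extend0 O f) i \_ O' = component f i \_ O.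
Proof.
move=> OO'; apply/funext => x; rewrite !patchE /component /extend0 /patch.
have [Ox|nOx] := boolP (x \in O); first by rewrite mem_set//; apply/OO'/set_mem.
by case: ifP => // _; rewrite mxE.
Qed.

(** An approximant of [f] is replaced by its extension by zero, read off its family. The error then
    vanishes almost everywhere off [O], so its L^2 norm is the same on both domains. *)
Lemma Espace_extend0 O O' f : open O -> hausdorff (boundary O) = 0%E ->
  closure O `<=` O' -> Espace O f -> Espace O' (extend0 O f).
Proof.
move=> oO bO cOO' [f2 fW].
have OO' : O `<=` O' by exact: subset_trans (@subset_closure _ O) cOO'.
split=> [i|eps /fW[w Ww we]]; first by rewrite /L2 extend0_patch//; exact: f2.
have [F DF wF] := Wspace_divfree Ww; have [F2 _ Foff _] := DF.
pose A i x := (component f i \_ O) x - F (inl i) x.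
have A2 i : A i \in Lfun lebesgue 2%:E by apply: Lfun2B; [exact: f2|exact: F2].
have A0 i : ae_eq lebesgue (~` O) (A i) (cst 0).
  apply: filterS (ae_eq_off_boundary oO bO (Foff (inl i))) => x e nOx.
  by rewrite /A e// patchE memNset// subr0.
have wA i : ae_eq lebesgue O (component (f \- w) i) (A i).
  apply: filterS (wF i) => x e Ox.
  by rewrite /A -e// patchE mem_set// /component !mxE.
exists (fun x => \row_i F (inl i) x).
  apply: (divfree_Wspace (divfree_sub _ DF)); last exact: represents_row.
  exact: subset_trans cOO' (@subset_closure _ O').
rewrite (@L2norm_representatives _ _ _ _ A)//.
- by rewrite -(L2norm_representatives A2 wA A0).
- move=> i; apply: aeW => x O'x.
  rewrite /A -(extend0_patch f i OO') patchE mem_set//.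
  by rewrite /component !mxE.
- by move=> i; apply: ae_eq_subset (A0 i); exact: subsetC.
Qed.

Lemma closure_open_boundary O x : open O -> closure O x -> ~ boundary O x -> O x.
Proof.
move=> oO cx nbx; apply: contrapT => nOx; apply: nbx.
by split=> //; rewrite (interior_id _).1.
Qed.

(** Up to the null boundaries the closures are the domains themselves, and what their intersection
    has outside the closure of [O] is null in every ball, by monotonicity of the measure and the
    assumed limit. *)
Lemma decreases_to_ae O (O_ : nat -> set Rd) : (forall n, open (O_ n)) ->
  (forall n, hausdorff (boundary (O_ n)) = 0%E) -> decreases_to O_ O ->
  \forall x \ae lebesgue, (forall n, closure (O_ n) x) -> closure O x.
Proof.
move=> oO_ bO_ [_ lim0].
pose N m := \bigcap_n ((O_ n `&` eball 0 m%:R) `\` closure O).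
have N0 m : lebesgue (N m) = 0%E.
  apply/eqP; rewrite eq_le outer_measure_ge0 andbT.
  have h := lim0 0 m%:R.
  rewrite -(cvg_lim (@ereal_hausdorff R) h).
  apply: lime_ge; first exact: cvgP h.
  apply: nearW => n; apply: (le_outer_measure lebesgue_outer).
  by move=> x; apply.
have aeN := ae_foralln (fun m => ae_not_null (N0 m)).
have aeb : \forall x \ae lebesgue, forall n, ~ boundary (O_ n) x.
  by apply: ae_foralln => n; exact/ae_not_null/hausdorff_null_lebesgue.
apply: filterS2 aeb aeN => x nb nN xO; apply: contrapT => ncx.
have [m _ xm] : exists2 m : nat, True & enorm x < m%:R.
  by exists (Num.bound (enorm x)) => //; apply: archi_boundP; exact: sqrtr_ge0.
apply: (nN m) => n _; split=> //; split; last by rewrite /eball/= subr0.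
exact: closure_open_boundary (oO_ n) (xO n) (nb n).
Qed.

Lemma resolvent_cvg (O : set Rd) (O_ : nat -> set Rd) f :
  open O -> (forall n, open (O_ n)) ->
  hausdorff (boundary O) = 0%E -> (forall n, hausdorff (boundary (O_ n)) = 0%E) ->
  decreases_to O_ O -> (forall n, closure O `<=` O_ n) -> Espace O f ->
  L2norm O (resolvent (O_ n) (extend0 O f) \- resolvent O f) @[n --> \oo] --> 0%E.
Proof.
move=> oO oO_ bO bO_ O_O cO_ Ef; set f0 := extend0 O f.
have OO_ n : O `<=` O_ n by exact: subset_trans (@subset_closure _ O) (cO_ n).
have E_ n : Espace (O_ n) f0 by exact: Espace_extend0.
have LPhi : L (extension_family O f) by apply: extension_family_L2; case: Ef.
(* All the resolvents are projections of one and the same vector: extending [f] by zero in one step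
   or in two gives the same family. *)
have PhiE n : extension_family (O_ n) f0 = extension_family O f.
  by apply/funext => -[i|//]; rewrite /extension_family/= extend0_patch.
have [res _] := resolventP oO bO Ef.
have [F [DF uF pF]] := (id_plus_stokesP _ oO bO Ef).1 res.
have /choice[F_ F_P] : forall n, exists G, [/\ divfree (O_ n) G,
    represents (O_ n) (resolvent (O_ n) f0) G &
    projects_on B (V (O_ n)) (extension_family O f) G].
  move=> n; have [resn _] := resolventP (oO_ n) (bO_ n) (E_ n).
  by rewrite -(PhiE n); apply/(id_plus_stokesP _ (oO_ n) (bO_ n) (E_ n)).
have q0 : B (F_ n - F) (F_ n - F) @[n --> \oo] --> 0.
  apply: (projection_cvg L0 Llin Bsym Blin Bge0 Bcomplete
    (Psi_ := fun n => divfree_tests (O_ n)) _ _ _ _ _ LPhi _ pF).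
  - by move=> n; exact: divfree_tests_L2.
  - exact: divfree_tests_L2.
  - move=> n G /divfreeP DG; apply/divfreeP; apply: divfree_sub DG.
    by apply: closureS; have [/(_ n)[]] := O_O.
  - move=> n G /divfreeP DG; apply/divfreeP; apply: divfree_sub DG.
    by apply: closureS.
  - move=> G VG; apply/divfreeP.
    have DG n : divfree (O_ n) G by apply/divfreeP; exact: VG.
    (* Only the vanishing condition involves the domain; the others can be taken from any index. *)
    have [G2 Gwp _ Gdiv] := DG 0%N; split=> // k.
    have Goff : \forall x \ae lebesgue, forall n,
        (~` closure (O_ n)) x -> G k x = cst 0 x.
      by apply: ae_foralln => n; have [_ _ /(_ k)] := DG n.
    apply: filterS2 Goff (decreases_to_ae oO_ bO_ O_O) => x Gx cx ncx.
    have /existsNP[n nx] : ~ forall n, closure (O_ n) x by move=> /cx.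
    exact: Gx nx.
  - by move=> n; have [] := F_P n.
have [F2 _ _ _] := DF.
pose A n i := (fun x => F_ n (inl i) x - F (inl i) x) \_ O.
have mO := measurable_open oO.
have FnF2 n i : (fun x => F_ n (inl i) x - F (inl i) x) \in Lfun lebesgue 2%:E.
  by have [[Fn2 _ _ _] _ _] := F_P n; apply: Lfun2B; [exact: Fn2|exact: F2].
have A2 n i : A n i \in Lfun lebesgue 2%:E by apply: Lfun2_restrict.
have normE n : L2norm O (resolvent (O_ n) f0 \- resolvent O f) =
    (Num.sqrt (\sum_i \int[lebesgue]_x (A n i x * A n i x)))%:E.
  apply: L2norm_representatives => // i.
    have [_ /(_ i) unF _] := F_P n.
    apply: filterS2 unF (uF i) => x e1 e2 Ox.
    rewrite /A patchE mem_set// -(e1 (OO_ n _ Ox)) -(e2 Ox).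
    by rewrite /component !mxE.
  by apply: aeW => x nOx; rewrite /A patchE memNset.
(* The families converge in the norm of H^1 over R^d; only the part of it that is the L^2 norm over
   [O] is kept. *)
have normle n : \sum_i \int[lebesgue]_x (A n i x * A n i x) <= B (F_ n - F) (F_ n - F).
  rewrite /family_inner big_sumType/=.
  apply: (@le_trans _ _ (\sum_i \int[lebesgue]_x
    ((F_ n - F) (inl i) x * (F_ n - F) (inl i) x))).
    apply: ler_sum => i _; apply: le_Rintegral => //.
    - exact: integrable_Lfun2M (A2 n i) (A2 n i).
    - exact: integrable_Lfun2M (FnF2 n i) (FnF2 n i).
    - move=> x _; rewrite /A patchE; case: ifP => // _.
      by rewrite mulr0 -expr2 sqr_ge0.
  rewrite lerDl; apply: sumr_ge0 => p _; apply: Rintegral_ge0 => x _.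
  by rewrite -expr2 sqr_ge0.
under eq_fun do rewrite normE.
apply: cvg_EFin; first exact: nearW.
have sq0 : Num.sqrt (B (F_ n - F) (F_ n - F)) @[n --> \oo] --> (0 : R).
  rewrite -[X in _ --> X]sqrtr0.
  exact: (cvg_comp _ _ q0 (@sqrt_continuous R 0)).
apply: (squeeze_cvgr _ (cvg_cst (0 : R)) sq0); apply: nearW => n.
by rewrite sqrtr_ge0/= ler_wsqrtr.
Qed.

End resolvent.

(** A [resolvent] is a value chosen by [get]; the clauses on [is_resolvent] ensure that the limit
    concerns the genuine inverses. *)
Theorem theorem4p2 (R : realType) (d : nat) (Omega : set 'rV[R]_d)
    (Omega_ : nat -> set 'rV[R]_d)
    (oO : open Omega) (bO : bounded_set Omega)
    (oO_ : forall n, open (Omega_ n)) (bO_ : forall n, bounded_set (Omega_ n))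
    (dO : hausdorff (boundary Omega) = 0%E)
    (dO_ : forall n, hausdorff (boundary (Omega_ n)) = 0%E)
    (O_O : decreases_to Omega_ Omega)
    (f : 'rV[R]_d -> 'rV[R]_d) (Ef : Espace Omega f) :
  let f0 := extend0 Omega f in
  [/\ forall n, Espace (Omega_ n) f0,
      forall n, is_resolvent (Omega_ n) f0 (resolvent (Omega_ n) f0),
      is_resolvent Omega f (resolvent Omega f) &
      L2norm Omega (resolvent (Omega_ n) f0 \- resolvent Omega f)
        @[n --> \oo] --> 0%E].
Proof.
move=> f0; have cO n : closure Omega `<=` Omega_ n.
  (* The inclusion of the closure is given for successor indices; index 0 follows because the
     domains decrease. *)
  case: n => [|n]; last by have [/(_ n)[]] := O_O.
  by have [/(_ 0%N)[s1 s2] _] := O_O; exact: subset_trans s2 s1.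
have E_ n : Espace (Omega_ n) f0 by exact: Espace_extend0.
split=> // [n||]; [exact: resolventP|exact: resolventP|exact: resolvent_cvg].
Qed.
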